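(* Let $K$ be a field, let $a,b$ be positive integers, and let $\mathcal{O}=\{x^iy^j\mid 0\le i<a,\ 0\le j<b\}$ be the box of type $(a,b)$ in $P=K[x,y]$. Write $\mathcal{O}=\{t_1,\dots,t_\mu\}$ and $\partial\mathcal{O}=\{b_1,\dots,b_\nu\}$. (a) An indeterminate $c_{ij}$ is $x$-exposed if and only if $t_i$ is a term in the right rim and $b_j$ is a term in the upper border of $\mathcal{O}$. In particular, the number of $x$-exposed indeterminates $c_{ij}$ is $ab$. (b) An indeterminate $c_{ij}$ is $y$-exposed if and only if $t_i$ is a term in the upper rim and $b_j$ is a term in the right border of $\mathcal{O}$. In particular, the number of $y$-exposed indeterminates $c_{ij}$ is $ab$. (c) The tuple $Z$ of all non-exposed indeterminates is a separating tuple of indeterminates for $I(\mathbb{B}_{\mathcal{O}})$. The $Z$-separating re-embedding yields a $K$-algebra isomorphism $\Phi: B_{\mathcal{O}}\longrightarrow K[C^{\rm exp}]$. In particular, every planar box border basis scheme is an affine cell, i.e., isomorphic to an affine space over $K$.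
   Context: The border of $\mathcal{O}$ is $\partial\mathcal{O}=(x\mathcal{O}\cup y\mathcal{O})\setminus\mathcal{O}$. For the box of type $(a,b)$: the right rim is $\{x^{a-1}y^k\mid 0\le k\le b-1\}$, the upper rim is $\{x^ky^{b-1}\mid 0\le k\le a-1\}$, the right border is $\{x^ay^k\mid 0\le k\le b-1\}$, the upper border is $\{x^ky^b\mid 0\le k\le a-1\}$. Let $c_{ij}$ ($1\le i\le\mu$, $1\le j\le\nu$) be indeterminates, $C=(c_{ij})$, $K[C]=K[c_{11},\dots,c_{\mu\nu}]$; put $x_1=x$, $x_2=y$. The generic multiplication matrix $\mathcal{A}_r\in\mathrm{Mat}_\mu(K[C])$ ($r=1,2$) has $(i,j)$ entry $\delta_{im}$ if $x_rt_j=t_m\in\mathcal{O}$ and $c_{im}$ if $x_rt_j=b_m\in\partial\mathcal{O}$. $I(\mathbb{B}_{\mathcal{O}})\subseteq K[C]$ is the ideal generated by the entries of $\mathcal{A}_1\mathcal{A}_2-\mathcal{A}_2\mathcal{A}_1$, $B_{\mathcal{O}}=K[C]/I(\mathbb{B}_{\mathcal{O}})$, and the border basis scheme is $\mathbb{B}_{\mathcal{O}}=\mathrm{Spec}(B_{\mathcal{O}})$ (a planar box border basis scheme when $\mathcal{O}$ is a box in two indeterminates). Exposed: $c_{ij}$ is $x_\ell$-exposed if $x_\ell t_i\in\partial\mathcal{O}$ and there is $j'$ such that $b_{j'}=x_\ell b_j$, or $x_kb_{j'}=x_\ell b_j$ for some $k\ne\ell$. $C^{\rm exp}$ is the tuple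 of all $c_{ij}$ which are $x$-exposed or $y$-exposed; the others are non-exposed. A tuple $Z=(z_1,\dots,z_s)$ of distinct indeterminates in $C$ is separating for an ideal $I\subseteq K[C]$ if there are $f_1,\dots,f_s\in I$ and a term ordering $\sigma$ with $\mathrm{LT}_\sigma(f_i)=z_i$ for all $i$. In this case there are $h_i\in K[C\setminus Z]$ with $z_i-h_i\in I$, and the $Z$-separating re-embedding is the isomorphism $K[C]/I\to K[C\setminus Z]/(I\cap K[C\setminus Z])$ given by $z_i\mapsto h_i$ and the identity on $C\setminus Z$. *)

(* Defs.v *)
From HB Require Import structures.
From mathcomp Require Import all_boot all_order all_algebra.
From mathcomp Require Import generic_quotient ring_quotient.
From mathcomp Require Import mpoly.
From mathcomp Require boolp.

Set Implicit Arguments.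
Unset Strict Implicit.
Unset Printing Implicit Defensive.

Import GRing.Theory.

Local Open Scope ring_scope.
Local Open Scope quotient_scope.

(* The library's {ideal_quot I} requires a proper ideal given by a boolean
   predicate; an arbitrary ideal, given as a Prop, is needed here. *)
Record ideal (R : comPzRingType) := Ideal {
  ideal_mem :> R -> Prop;
  ideal_mem0 : ideal_mem 0;
  ideal_memD : forall p q, ideal_mem p -> ideal_mem q -> ideal_mem (p + q);
  ideal_memM : forall p q, ideal_mem q -> ideal_mem (p * q)
}.

Section GeneratedIdeal.
Variables (R : comPzRingType) (J : finType) (g : J -> R).

Definition generated (p : R) := exists q : J -> R, p = \sum_j q j * g j.

Lemma generated0 : generated 0.
Proof. by exists (fun=> 0); rewrite big1 // => j _; rewrite mul0r. Qed.

Lemma generatedD p q : generated p -> generated q -> generated (p + q).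
Proof.
move=> [u ->] [v ->]; exists (fun j => u j + v j).
by rewrite -big_split; apply: eq_bigr => j _; rewrite /= mulrDl.
Qed.

Lemma generatedM p q : generated q -> generated (p * q).
Proof.
move=> [v ->]; exists (fun j => p * v j).
by rewrite mulr_sumr; apply: eq_bigr => j _; rewrite mulrA.
Qed.

Definition gen_ideal : ideal R := Ideal generated0 generatedD generatedM.

End GeneratedIdeal.

Section Contraction.
Variables (R S : comPzRingType) (f : {rmorphism R -> S}) (I : ideal S).

Lemma contract0 : I (f 0).
Proof. by rewrite rmorph0; apply: ideal_mem0. Qed.

Lemma contractD p q : I (f p) -> I (f q) -> I (f (p + q)).
Proof. by rewrite rmorphD; apply: ideal_memD. Qed.

Lemma contractM p q : I (f q) -> I (f (p * q)).
Proof. by rewrite rmorphM; apply: ideal_memM. Qed.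

Definition contraction : ideal R :=
  @Ideal R (fun p => I (f p)) contract0 contractD contractM.

End Contraction.

Section Quotient.
Variables (R : comPzRingType) (I : ideal R).

Definition ideal_pred : {pred R} := fun p => boolp.asbool (I p).

Lemma ideal_predP p : reflect (I p) (p \in ideal_pred).
Proof. exact: boolp.asboolP. Qed.

Lemma ideal_pred_zmod : zmod_closed ideal_pred.
Proof.
split=> [|p q /ideal_predP Ip /ideal_predP Iq]; apply/ideal_predP.
  exact: ideal_mem0.
by apply: ideal_memD => //; rewrite -mulN1r; apply: ideal_memM.
Qed.

HB.instance Definition _ := GRing.isZmodClosed.Build R ideal_pred ideal_pred_zmod.

Definition quotient : Type := Quotient.quot ideal_pred.

HB.instance Definition _ := GRing.Zmodule.on quotient.

Definition proj (p : R) : quotient := \pi_(Quotient.quot ideal_pred) p.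
Definition qrepr (u : quotient) : R :=
  repr (u : Quotient.quot ideal_pred).

Lemma qreprK : cancel qrepr proj.
Proof. exact: reprK. Qed.

Lemma projP p q : proj p = proj q <-> I (p - q).
Proof.
split=> [/eqP|Ipq]; last apply/eqP.
  by rewrite -Quotient.idealrBE => /ideal_predP.
by rewrite -Quotient.idealrBE; apply/ideal_predP.
Qed.

Lemma proj_qrepr p : I (qrepr (proj p) - p).
Proof. by apply/projP; rewrite qreprK. Qed.

Lemma proj_zmod : zmod_morphism proj.
Proof. exact: (raddfB \pi_(Quotient.quot ideal_pred)). Qed.

HB.instance Definition _ :=
  GRing.isZmodMorphism.Build R quotient proj proj_zmod.

Definition qone : quotient := proj 1.
Definition qmul (u v : quotient) : quotient := proj (qrepr u * qrepr v).

Lemma proj_qmul p q : proj (p * q) = qmul (proj p) (proj q).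
Proof.
apply/esym/projP; set p' := qrepr _; set q' := qrepr _.
have -> : p' * q' - p * q = q' * (p' - p) + p * (q' - q).
  by rewrite !mulrBr mulrC (mulrC q' p) addrA addrNK.
by apply: ideal_memD; apply: ideal_memM; apply: proj_qrepr.
Qed.

Lemma qmulA : associative qmul.
Proof.
move=> u v w; rewrite -(qreprK u) -(qreprK v) -(qreprK w).
by rewrite -(proj_qmul (qrepr v)) -!(proj_qmul (qrepr u)) -proj_qmul mulrA.
Qed.

Lemma qmulC : commutative qmul.
Proof. by move=> u v; rewrite /qmul mulrC. Qed.

Lemma qmul1 : left_id qone qmul.
Proof. by move=> u; rewrite -(qreprK u) -proj_qmul mul1r. Qed.

Lemma qmulDl : left_distributive qmul +%R.
Proof.
move=> u v w; rewrite -(qreprK u) -(qreprK v) -(qreprK w).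
by rewrite -raddfD -!proj_qmul mulrDl raddfD.
Qed.

HB.instance Definition _ :=
  GRing.Zmodule_isComPzRing.Build quotient qmulA qmulC qmul1 qmulDl.

Lemma proj_monoid : monoid_morphism proj.
Proof. by split=> // p q; apply: proj_qmul. Qed.

HB.instance Definition _ :=
  GRing.isMonoidMorphism.Build R quotient proj proj_monoid.

End Quotient.

(* The library's comAlgType excludes the zero ring, which must be allowed both
   as a quotient and as a test algebra for functors of points. *)
Record kalg (K : fieldType) := KAlg {
  kalg_ring :> comPzRingType;
  kalg_str : {rmorphism K -> kalg_ring}
}.

Record kalg_hom (K : fieldType) (A B : kalg K) := KAlgHom {
  kalg_fun :> {rmorphism A -> B};
  kalg_funP : forall k : K, kalg_fun (kalg_str A k) = kalg_str B k
}.

Lemma kalg_hom_ext (K : fieldType) (A B : kalg K) (f g : kalg_hom A B) :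
  f =1 g -> f = g.
Proof.
case: f => [[f [[fA] [fM]]] hf]; case: g => [[g [[gA] [gM]]] hg] /= efg.
have {}efg : f = g by apply: boolp.funext.
case: _ / efg in gA gM hg *.
rewrite (boolp.Prop_irrelevance gA fA) (boolp.Prop_irrelevance gM fM) in hg *.
by rewrite (boolp.Prop_irrelevance hg hf).
Qed.

Section KAlgebras.
Variable K : fieldType.
Implicit Types A B C : kalg K.

Lemma kalg_comp_proof A B C (g : kalg_hom B C) (f : kalg_hom A B) (k : K) :
  (g \o f) (kalg_str A k) = kalg_str C k.
Proof. by rewrite /= !kalg_funP. Qed.

Definition kalg_comp A B C (g : kalg_hom B C) (f : kalg_hom A B) :
  kalg_hom A C := @KAlgHom K A C (g \o f) (kalg_comp_proof g f).

Definition kalg_iso A B (f : kalg_hom A B) := bijective f.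

Definition kpoly (n : nat) : kalg K := @KAlg K {mpoly K[n]} (@mpolyC n K).

Definition kquotient A (I : ideal A) : kalg K :=
  @KAlg K (quotient I) (@proj A I \o kalg_str A).

(* K-schemes are represented by their functors of points. *)
Record kfunctor := KFunctor {
  points :> kalg K -> Type;
  points_map : forall A B, kalg_hom A B -> points A -> points B
}.

Definition Spec B : kfunctor :=
  @KFunctor (fun A => kalg_hom B A) (fun A A' g f => kalg_comp g f).

Definition affine_space (n : nat) : kfunctor := Spec (kpoly n).

Definition kfunctor_iso (F G : kfunctor) : Prop :=
  exists eta : forall A, F A -> G A,
    (forall A, bijective (eta A)) /\
    (forall A A' (g : kalg_hom A A') (x : F A),
       eta A' (points_map g x) = points_map g (eta A x)).

End KAlgebras.

Section Separating.
Variables (K : fieldType) (n : nat).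
Implicit Types (m : 'X_{1..n}) (I : ideal (kpoly K n)).

Record term_ordering (le : rel 'X_{1..n}) : Prop := TermOrdering {
  to_total : total le;
  to_anti : antisymmetric le;
  to_trans : transitive le;
  to_add : forall m1 m2 m, le m1 m2 -> le (m1 + m)%MM (m2 + m)%MM;
  to_min : forall m, le 0%MM m
}.

Definition is_leading_term (le : rel 'X_{1..n}) (f : {mpoly K[n]}) m :=
  m \in msupp f /\ forall m', m' \in msupp f -> le m' m.

Definition separating I (Z : {set 'I_n}) : Prop :=
  exists2 le : rel 'X_{1..n}, term_ordering le &
    forall z, z \in Z -> exists2 f, I f & is_leading_term le f U_(z)%MM.

(* K[Y] is {mpoly K[#|Y|]}, whose k-th indeterminate stands for the k-th
   element of the set Y of indeterminates. *)
Definition incl (Y : {set 'I_n}) : {mpoly K[#|Y|]} -> {mpoly K[n]} :=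
  mmap (@mpolyC n K) (fun k => 'X_(enum_val k)).

Arguments incl : clear implicits.

HB.instance Definition _ (Y : {set 'I_n}) := GRing.RMorphism.on (incl Y).

Definition elim_ideal I (Y : {set 'I_n}) : ideal (kpoly K #|Y|) :=
  contraction (incl Y) I.

(* psi is the (~: Y)-separating re-embedding: Y is the set of the
   indeterminates that are kept. *)
Definition is_reembedding I (Y : {set 'I_n})
    (psi : kalg_hom (kquotient I) (kquotient (elim_ideal I Y))) : Prop :=
  kalg_iso psi /\
  exists2 h : 'I_n -> {mpoly K[#|Y|]},
    forall z, z \notin Y -> I ('X_z - incl Y (h z)) &
    (forall z, z \notin Y ->
       psi (proj I 'X_z) = proj (elim_ideal I Y) (h z)) /\
    (forall k : 'I_#|Y|,
       psi (proj I 'X_(enum_val k)) = proj (elim_ideal I Y) 'X_k).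

End Separating.

Notation term := 'X_{1..2}.
Definition ix : 'I_2 := ord0.
Definition iy : 'I_2 := ord_max.
Definition xy (i j : nat) : term := (U_(ix) *+ i + U_(iy) *+ j)%MM.
Definition shift (r : 'I_2) (m : term) : term := (U_(r) + m)%MM.

Definition border (O : seq term) : seq term :=
  [seq m <- [seq shift ix m | m <- O] ++ [seq shift iy m | m <- O]
     | m \notin O].

Definition box (a b : nat) : seq term :=
  [seq xy i j | i <- iota 0 a, j <- iota 0 b].
Definition right_rim (a b : nat) : seq term :=
  [seq xy a.-1 k | k <- iota 0 b].
Definition upper_rim (a b : nat) : seq term :=
  [seq xy k b.-1 | k <- iota 0 a].
Definition right_border (a b : nat) : seq term :=
  [seq xy a k | k <- iota 0 b].
Definition upper_border (a b : nat) : seq term :=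
  [seq xy k b | k <- iota 0 a].

Section BorderBasisScheme.
Variables (mu nu : nat) (t : mu.-tuple term) (bd : nu.-tuple term).

Definition exposed (l : 'I_2) (i : 'I_mu) (j : 'I_nu) : bool :=
  (shift l (tnth t i) \in bd) &&
  [exists j' : 'I_nu,
     (tnth bd j' == shift l (tnth bd j)) ||
     [exists k : 'I_2, (k != l) &&
        (shift k (tnth bd j') == shift l (tnth bd j))]].

(* The indeterminate c_ij is 'X_(mxvec_index i j). *)
Definition Cexp : {set 'I_(mu * nu)} :=
  [set mxvec_index ij.1 ij.2 | ij : 'I_mu * 'I_nu
     & exposed ix ij.1 ij.2 || exposed iy ij.1 ij.2].

Variable K : fieldType.

Definition mult_mx (r : 'I_2) : 'M[{mpoly K[mu * nu]}]_mu :=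
  \matrix_(i, j)
    if [pick m | tnth t m == shift r (tnth t j)] is Some m then (i == m)%:R
    else if [pick m | tnth bd m == shift r (tnth t j)] is Some m
         then 'X_(mxvec_index i m)
    else 0.

Definition bbs_ideal : ideal (kpoly K (mu * nu)) :=
  gen_ideal (fun ij : 'I_mu * 'I_mu =>
    (mult_mx ix *m mult_mx iy - mult_mx iy *m mult_mx ix) ij.1 ij.2).

Definition bbs_algebra : kalg K := kquotient bbs_ideal.
Definition border_basis_scheme : kfunctor K := Spec bbs_algebra.

End BorderBasisScheme.

(* Main.v *)
Require Import Defs.
From HB Require Import structures.
From mathcomp Require Import all_boot all_order all_algebra.
From mathcomp Require Import mpoly.
From mathcomp Require Import zify.
From mathcomp Require boolp.

Set Implicit Arguments.
Unset Strict Implicit.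
Unset Printing Implicit Defensive.

Import Order.TTheory GRing.Theory.
Local Open Scope ring_scope.

(** Write p_l and q_k for the normal forms of x^a y^l and of x^k y^b, for l < b
    and k < a; the indeterminates are the coefficients of these polynomials at
    the terms x^i y^j of the box.  The multiplication matrices commute if and
    only if p_(l+1) = y p_l, q_(k+1) = x q_k and x q_(a-1) = y p_(b-1), where
    the products are reduced to the box.  Reducing y p_l shifts p_l upwards and
    adds, for each k, the coefficient of p_l at x^k y^(b-1) times q_k; the
    coefficients that occur here as multipliers are exactly the y-exposed
    indeterminates.  In the same way, reducing x q_k multiplies the p_l by
    x-exposed indeterminates.  The defining relations are thus linear in the
    non-exposed indeterminates, with coefficients in K[Cexp].

    This linear system contains a triangular one.  The coefficient of p_l at
    x^i y^j, for j < b-1, is solved from the relation between p_(l+1) (or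
    x q_(a-1) if l = b-1) and y p_l at x^i y^(j+1), which involves only
    coefficients one row higher.  The coefficient of q_k at x^i y^j, for
    i < a-1, is solved within row j: by moving to q_(k+1) at x^(i+1) y^j if
    k <= i, and to q_(k-1) at x^(i-1) y^j if k > i; the additional terms are
    coefficients of the p_l in row j.  Weighting the indeterminates accordingly
    gives the separating term ordering ([bbs_separating]), and solving the
    triangular system defines phi : K[C] -> K[Cexp], which is the identity on
    K[Cexp] and congruent to the identity modulo the ideal ([solution_mod]).

    It remains to see that phi kills the relations that were not used, for then
    the quotient is K[Cexp] and the elimination ideal is zero ([retraction_reembedding]).
    Let X, Y be the images of the multiplication matrices under phi.  The
    unused relations are the entries of D = XY - YX in the rows x^i and the
    columns x^(a-1) y^l, and all other entries of D vanish.  Since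
    tr (D X^m) = 0 for every m, these ab entries satisfy ab homogeneous linear
    equations over K[Cexp], whose coefficients are entries of powers of X
    ([trace_relation]).  The determinant of this system is a nonzero
    polynomial: at the point of K[Cexp] that represents the ideal
    (x^a - y, y^b), the box terms form a single chain 1, x, ..., x^(ab-1) under
    X and the system becomes the identity ([trace_mx_chain]).  As K[Cexp] is a
    domain, D = 0. *)

(** * Weights and weighted term orderings *)

Section Weights.
Variables (K : fieldType) (n : nat) (w : 'I_n -> nat).
Implicit Types (m : 'X_{1..n}) (f g : {mpoly K[n]}).

Definition mweight m := (\sum_i w i * m i)%N.

Lemma mweight0 : mweight 0%MM = 0%N.
Proof. by rewrite /mweight big1 // => i _; rewrite mnm0E muln0. Qed.

Lemma mweightD m1 m2 : mweight (m1 + m2)%MM = (mweight m1 + mweight m2)%N.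
Proof.
by rewrite /mweight -big_split; apply: eq_bigr => i _; rewrite mnmDE mulnDr.
Qed.

Lemma mweightU i : mweight U_(i)%MM = w i.
Proof.
rewrite /mweight (bigD1 i) //= mnm1E eqxx muln1 big1 ?addn0 // => j ji.
by rewrite mnm1E eq_sym (negbTE ji) muln0.
Qed.

Lemma leq_mweight m i : (0 < m i)%N -> (w i <= mweight m)%N.
Proof.
by move=> mi; rewrite /mweight (bigD1 i) //= -(prednK mi) mulnS -addnA leq_addr.
Qed.

(** The second component separates terms of equal weight, in particular all
    terms in indeterminates of weight 0. *)
Definition weight_le m1 m2 :=
  (mweight m1 < mweight m2)%N || (mweight m1 == mweight m2) && (m1 <= m2)%O.

Lemma weight_le_term_ordering : term_ordering weight_le.
Proof.
split; rewrite /weight_le.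
- move=> m1 m2; case: ltngtP => //= _; exact: le_total.
- move=> m1 m2; case: ltngtP => //= _; exact: le_anti.
- move=> m2 m1 m3 /orP[lt12|/andP[/eqP-> le12]] /orP[lt23|/andP[/eqP<- le23]].
  + by rewrite (ltn_trans lt12 lt23).
  + by rewrite lt12.
  + by rewrite lt23.
  + by rewrite eqxx (le_trans le12 le23) orbT.
- by move=> m1 m2 m; rewrite !mweightD ltn_add2r eqn_add2r lemc_add2l.
- by move=> m; rewrite mweight0 le0x andbT; case: mweight.
Qed.

Definition weight_lt (d : nat) f := forall m, m \in msupp f -> (mweight m < d)%N.

Lemma weight_lt0 d : weight_lt d 0.
Proof. by move=> m; rewrite msupp0. Qed.

Lemma weight_ltD d f g : weight_lt d f -> weight_lt d g -> weight_lt d (f + g).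
Proof. by move=> hf hg m /msuppD_le; rewrite mem_cat => /orP[/hf|/hg]. Qed.

Lemma weight_ltN d f : weight_lt d f -> weight_lt d (- f).
Proof. by move=> hf m; rewrite (perm_mem (msuppN f)) => /hf. Qed.

Lemma weight_lt_sum d k (F : 'I_k -> {mpoly K[n]}) :
  (forall i, weight_lt d (F i)) -> weight_lt d (\sum_i F i).
Proof.
by move=> hF; elim/big_rec: _ => [|i f _]; [exact: weight_lt0 | exact: weight_ltD].
Qed.

Lemma weight_ltX d i : (w i < d)%N -> weight_lt d 'X_i.
Proof. by move=> wi m; rewrite msuppX inE => /eqP->; rewrite mweightU. Qed.

(** Indeterminates of weight 0 are coefficients: this is why the kept
    indeterminates get weight 0, and why quadratic relations that are linear in
    the other ones can be oriented. *)
Lemma weight_ltXM d i f : w i = 0%N -> weight_lt d f -> weight_lt d ('X_i * f).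
Proof.
move=> wi hf m /msuppM_le /allpairsP[[m1 m2] /= [m1i /hf m2f ->]].
by move: m1i; rewrite msuppX inE => /eqP->; rewrite mweightD mweightU wi.
Qed.

(** The induction step of every argument by weight below: a polynomial of
    weight less than d only sees the values of a morphism at indeterminates of
    weight less than d.  The codomain may be the zero ring, so that the lemma
    applies to quotients by arbitrary ideals. *)
Lemma eq_rmorphism_weight (R : comPzRingType)
    (phi psi : {rmorphism {mpoly K[n]} -> R}) d f :
    (forall k : K, phi k%:MP = psi k%:MP) ->
    (forall i, (w i < d)%N -> phi 'X_i = psi 'X_i) ->
  weight_lt d f -> phi f = psi f.
Proof.
move=> eqC eqX hf; rewrite [f]mpolyE !raddf_sum /=; apply: eq_big_seq => m mf.
rewrite -mul_mpolyC !rmorphM eqC mpolyXE_id !rmorph_prod; congr (_ * _).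
apply: eq_bigr => i _; rewrite !rmorphXn /=.
case: (posnP (m i)) => [->|mi]; first by rewrite !expr0.
by rewrite eqX //; apply: leq_ltn_trans (hf _ mf); apply: leq_mweight.
Qed.

End Weights.

Lemma eq_mpoly_rmorphism (K : fieldType) n (R : comPzRingType)
    (phi psi : {rmorphism {mpoly K[n]} -> R}) :
    (forall k : K, phi k%:MP = psi k%:MP) ->
    (forall i, phi 'X_i = psi 'X_i) ->
  phi =1 psi.
Proof.
move=> eqC eqX f; apply: (@eq_rmorphism_weight _ _ (fun=> 0%N) _ _ _ 1) => //.
by move=> m _; rewrite /mweight big1.
Qed.

(** * Triangular systems of substitutions *)

Section Triangular.
Variables (K : fieldType) (n : nat) (Y : {set 'I_n}) (w : 'I_n -> nat).
Variable h : 'I_n -> {mpoly K[n]}.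
Hypothesis h_lt : forall z, z \notin Y -> weight_lt w (w z) (h z).

(** All terms of h z have weight less than that of z, hence z is the leading
    term of z - h z for the weighted ordering. *)
Lemma triangular_separating (I : ideal (kpoly K n)) :
  (forall z, z \notin Y -> I ('X_z - h z)) -> separating I (~: Y).
Proof.
move=> Ih; exists (weight_le w); first exact: weight_le_term_ordering.
move=> z; rewrite inE => zY; exists ('X_z - h z); first exact: Ih.
have zh m : m \in msupp (h z) -> (mweight w m < mweight w U_(z))%N.
  by rewrite mweightU; apply: h_lt.
split=> [|m /msuppB_le].
  rewrite mcoeff_msupp mcoeffB mcoeffX eqxx memN_msupp_eq0 ?subr0 ?oner_eq0 //.
  by apply/negP => /zh; rewrite ltnn.
rewrite mem_cat msuppX inE => /orP[/eqP->|/zh lt_m].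
  by rewrite /weight_le eqxx lexx orbT.
by rewrite /weight_le lt_m.
Qed.

(** Used to identify a specialization of the solution without computing the
    solution itself. *)
Lemma triangular_unique (R : comNzRingType) (f : {rmorphism K -> R})
    (u v : 'I_n -> R) :
    (forall y, y \in Y -> u y = v y) ->
    (forall z, z \notin Y -> u z = mmap f u (h z)) ->
    (forall z, z \notin Y -> v z = mmap f v (h z)) ->
  u =1 v.
Proof.
move=> eqY uh vh z; have [d] := ubnP (w z).
elim: d z => // d IHd z lt_z; have [/eqY//|zY] := boolP (z \in Y).
rewrite uh // vh //; apply: (eq_rmorphism_weight _ _ (h_lt zY)) => [k|i lt_i].
  by rewrite /= !mmapC.
rewrite /= !mmapX !mmap1U; apply: IHd.
by apply: leq_trans lt_i _; rewrite -ltnS.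
Qed.

(** The substitution z |-> h z iterated d times, with 0 for what is then still
    unresolved; the value at z no longer changes once d exceeds the weight
    of z. *)
Fixpoint solution_upto (d : nat) (z : 'I_n) : {mpoly K[#|Y|]} :=
  if [pick k : 'I_#|Y| | enum_val k == z] is Some k then 'X_k else
  if d is d'.+1 then mmap (@mpolyC _ K) (solution_upto d') (h z) else 0.

Lemma solution_upto_kept d (k : 'I_#|Y|) : solution_upto d (enum_val k) = 'X_k.
Proof.
have: [pick k' : 'I_#|Y| | enum_val k' == enum_val k] = Some k.
  case: pickP => [k' /eqP/enum_val_inj->//|/(_ k)]; by rewrite eqxx.
by case: d => [|d] /= ->.
Qed.

Lemma solution_uptoS d z : z \notin Y ->
  solution_upto d.+1 z = mmap (@mpolyC _ K) (solution_upto d) (h z).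
Proof.
move=> zY /=; case: pickP => // k /eqP kz.
by rewrite -kz enum_valP in zY.
Qed.

Lemma solution_upto_stable d z :
  (w z < d)%N -> solution_upto d.+1 z = solution_upto d z.
Proof.
elim: d z => // d IHd z lt_z; have [zY|zY] := boolP (z \in Y).
  by rewrite -(enum_rankK_in zY zY) !solution_upto_kept.
rewrite !solution_uptoS //.
apply: (eq_rmorphism_weight _ _ (h_lt zY)) => [k|i lt_i].
  by rewrite /= !mmapC.
rewrite /= !mmapX !mmap1U; apply: IHd.
by apply: leq_trans lt_i _; rewrite -ltnS.
Qed.

Definition solution : 'I_n -> {mpoly K[#|Y|]} :=
  solution_upto (\max_i w i).+1.

Lemma solution_kept (k : 'I_#|Y|) : solution (enum_val k) = 'X_k.
Proof. exact: solution_upto_kept. Qed.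

Lemma solutionE z :
  z \notin Y -> solution z = mmap (@mpolyC _ K) solution (h z).
Proof.
move=> zY; rewrite -solution_uptoS // solution_upto_stable //.
by rewrite ltnS leq_bigmax.
Qed.

(** By induction on the weight: modulo I the indeterminate z is h z, and the
    indeterminates in h z are congruent to their solutions. *)
Lemma solution_mod (I : ideal (kpoly K n)) :
    (forall z, z \notin Y -> I ('X_z - h z)) ->
  forall z, I ('X_z - @incl K n Y (solution z)).
Proof.
move=> Ih z; have [d] := ubnP (w z).
elim: d z => // d IHd z lt_z; have [zY|zY] := boolP (z \in Y).
  rewrite -(enum_rankK_in zY zY) solution_kept /incl mmapX mmap1U subrr.
  exact: ideal_mem0.
apply/projP; have /projP -> := Ih _ zY; rewrite solutionE //.
pose phi : {rmorphism {mpoly K[n]} -> quotient I} :=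
  @proj _ I \o @incl K n Y \o mmap (@mpolyC _ K) solution.
apply: (@eq_rmorphism_weight _ _ w _ (@proj _ I) phi (w z)) (h_lt zY).
  by move=> k; rewrite /phi /= /incl !mmapC.
move=> i lt_i; rewrite /phi /= mmapX mmap1U; apply/projP; apply: IHd.
by apply: leq_trans lt_i _; rewrite -ltnS.
Qed.

End Triangular.

(** * Quotients and retractions onto a polynomial subring *)

Lemma ideal_memBC (R : comPzRingType) (I : ideal R) p q : I (p - q) -> I (q - p).
Proof. by move=> Ipq; rewrite -opprB -mulN1r; apply: ideal_memM. Qed.

Section QuotientMaps.
Variables (K : fieldType) (A : kalg K) (I : ideal A).

Lemma proj_homP (k : K) :
  @proj A I (kalg_str A k) = kalg_str (kquotient I) k.
Proof. by []. Qed.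

Definition proj_hom : kalg_hom A (kquotient I) :=
  @KAlgHom K A (kquotient I) (@proj A I) proj_homP.

Variables (B : kalg K) (f : kalg_hom A B).
Hypothesis f_kill : forall p, I p -> f p = 0.

Definition quotient_lift (u : quotient I) : B := f (qrepr u).

Lemma quotient_liftE p : quotient_lift (proj I p) = f p.
Proof.
by apply/eqP; rewrite -subr_eq0 -rmorphB; apply/eqP/f_kill/proj_qrepr.
Qed.

Lemma quotient_lift_zmod : zmod_morphism quotient_lift.
Proof.
move=> u v; rewrite -(qreprK u) -(qreprK v) -raddfB.
by rewrite !quotient_liftE rmorphB.
Qed.

Lemma quotient_lift_monoid : monoid_morphism quotient_lift.
Proof.
split=> [|u v]; first by rewrite -[1]/(proj I 1) quotient_liftE rmorph1.
rewrite -(qreprK u) -(qreprK v) -rmorphM.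
by rewrite !quotient_liftE rmorphM.
Qed.

HB.instance Definition _ :=
  GRing.isZmodMorphism.Build (quotient I) B quotient_lift quotient_lift_zmod.
HB.instance Definition _ :=
  GRing.isMonoidMorphism.Build (quotient I) B quotient_lift quotient_lift_monoid.

Lemma quotient_lift_homP (k : K) :
  quotient_lift (kalg_str (kquotient I) k) = kalg_str B k.
Proof. by rewrite quotient_liftE kalg_funP. Qed.

Definition quotient_hom : kalg_hom (kquotient I) B :=
  @KAlgHom K (kquotient I) B quotient_lift quotient_lift_homP.

End QuotientMaps.

(** The easy direction of the Yoneda lemma. *)
Lemma kfunctor_iso_Spec (K : fieldType) (A B : kalg K)
    (f : kalg_hom A B) (g : kalg_hom B A) :
  cancel f g -> cancel g f -> kfunctor_iso (Spec A) (Spec B).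
Proof.
move=> fK gK; exists (fun R (x : kalg_hom A R) => kalg_comp x g); split=> [R|].
  exists (fun y : kalg_hom B R => kalg_comp y f) => x;
  by apply: kalg_hom_ext => u /=; rewrite ?fK ?gK.
by move=> R R' r x; apply: kalg_hom_ext.
Qed.

(** The ideal I is the kernel of a retraction phi of K[C] onto K[Y]: phi kills I,
    and it is the identity modulo I.  Hence K[C]/I is K[Y], I meets K[Y] only
    in 0, and the re-embedding that sends z to phi z is an isomorphism. *)
Section Retraction.
Variables (K : fieldType) (n : nat) (I : ideal (kpoly K n)) (Y : {set 'I_n}).
Variable phi : 'I_n -> {mpoly K[#|Y|]}.
Hypothesis phi_kept : forall k, phi (enum_val k) = 'X_k.
Hypothesis phi_mod : forall z, I ('X_z - @incl K n Y (phi z)).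
Hypothesis phi_kill : forall f, I f -> mmap (@mpolyC _ K) phi f = 0.

Let ev : {rmorphism {mpoly K[n]} -> {mpoly K[#|Y|]}} := mmap (@mpolyC _ K) phi.

Lemma retractionK p : ev (incl p) = p.
Proof.
apply: (@eq_mpoly_rmorphism _ _ _ (ev \o @incl K n Y) idfun) => [k|i] /=.
  by rewrite /incl !mmapC.
by rewrite /ev /incl /= !(mmapX, mmap1U) phi_kept.
Qed.

Lemma retraction_mod f : proj I (incl (ev f)) = proj I f.
Proof.
apply: (@eq_mpoly_rmorphism _ _ _ (@proj _ I \o @incl K n Y \o ev) (@proj _ I)).
  by move=> k; rewrite /= /incl !mmapC.
by move=> i; apply/esym/projP; rewrite /ev /= mmapX mmap1U; apply: phi_mod.
Qed.

Lemma retraction_elim p : elim_ideal I Y p -> p = 0.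
Proof. by move=> Ip; rewrite -(retractionK p); apply: phi_kill. Qed.

Lemma retraction_homP (k : K) : ev (kalg_str (kpoly K n) k) = kalg_str (kpoly K #|Y|) k.
Proof. exact: mmapC. Qed.

Lemma incl_homP (k : K) : @incl K n Y (kalg_str (kpoly K #|Y|) k) = kalg_str (kpoly K n) k.
Proof. exact: mmapC. Qed.

Let ev_hom : kalg_hom (kpoly K n) (kpoly K #|Y|) :=
  @KAlgHom K (kpoly K n) (kpoly K #|Y|) ev retraction_homP.
Let Phi : kalg_hom (kquotient I) (kpoly K #|Y|) :=
  @quotient_hom K (kpoly K n) I _ ev_hom phi_kill.
Let incl_hom : kalg_hom (kpoly K #|Y|) (kpoly K n) :=
  @KAlgHom K (kpoly K #|Y|) (kpoly K n) (@incl K n Y) incl_homP.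
Let Phi' : kalg_hom (kpoly K #|Y|) (kquotient I) :=
  kalg_comp (@proj_hom K (kpoly K n) I) incl_hom.
Let Psi : kalg_hom (kquotient I) (kquotient (elim_ideal I Y)) :=
  kalg_comp (@proj_hom K (kpoly K #|Y|) (elim_ideal I Y)) Phi.

Let PhiE f : Phi (proj I f) = ev f.
Proof. exact: (@quotient_liftE K (kpoly K n) I _ ev_hom). Qed.

Let PhiK : cancel Phi Phi'.
Proof. by move=> u; rewrite -(qreprK u) PhiE; apply: retraction_mod. Qed.

Let Phi'K : cancel Phi' Phi.
Proof. by move=> p; rewrite /Phi' PhiE retractionK. Qed.

Lemma proj_elim_bij : bijective (@proj (kpoly K #|Y|) (elim_ideal I Y)).
Proof.
exists (@qrepr _ _) => [p|]; last exact: qreprK.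
by apply/eqP; rewrite -subr_eq0; apply/eqP/retraction_elim/proj_qrepr.
Qed.

Lemma retraction_reembedding :
  exists (Psi : kalg_hom (kquotient I) (kquotient (elim_ideal I Y)))
         (Phi : kalg_hom (kquotient I) (kpoly K #|Y|)),
    [/\ is_reembedding Psi,
        forall u, proj (elim_ideal I Y) (Phi u) = Psi u & kalg_iso Phi].
Proof.
exists Psi, Phi; split=> //; last by exists Phi'.
split; first by apply: bij_comp proj_elim_bij _; exists Phi'.
exists phi => [z _|]; first exact: phi_mod.
split=> [z _|k]; congr (proj _ _).
  by rewrite PhiE /ev /= mmapX mmap1U.
by rewrite PhiE /ev /= mmapX mmap1U phi_kept.
Qed.

Lemma retraction_affine : kfunctor_iso (Spec (kquotient I)) (affine_space K #|Y|).
Proof. exact: kfunctor_iso_Spec PhiK Phi'K. Qed.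

End Retraction.

(** * Terms, borders and exposed indeterminates *)

Lemma xyEx i j : xy i j ix = i.
Proof.
by rewrite /xy mnmDE !mulmnE !mnm1E eqxx (_ : (iy == ix) = false) // mul1n addn0.
Qed.

Lemma xyEy i j : xy i j iy = j.
Proof.
by rewrite /xy mnmDE !mulmnE !mnm1E eqxx (_ : (ix == iy) = false) // mul1n add0n.
Qed.

Lemma xyK (m : term) : xy (m ix) (m iy) = m.
Proof.
apply/mnmP => r; have [->|->] : r = ix \/ r = iy; rewrite ?xyEx ?xyEy //.
by case: r => [[|[|]]] // lt_r; [left | right]; apply: val_inj.
Qed.

Lemma eq_xy (m : term) i j : (m == xy i j) = (m ix == i) && (m iy == j).
Proof.
apply/eqP/andP => [->|[/eqP<- /eqP<-]]; last by rewrite xyK.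
by rewrite xyEx xyEy !eqxx.
Qed.

Lemma shift_ix i j : shift ix (xy i j) = xy i.+1 j.
Proof. by rewrite /shift /xy mulmS addmA. Qed.

Lemma shift_iy i j : shift iy (xy i j) = xy i j.+1.
Proof. by rewrite /shift /xy mulmS addmA (addmC U_(iy)%MM) -addmA. Qed.

Lemma mem_box a b (m : term) : (m \in box a b) = (m ix < a)%N && (m iy < b)%N.
Proof.
apply/allpairsP/andP => [[[i j] /= []]|[ma mb]].
  by rewrite !mem_iota => ia jb ->; rewrite xyEx xyEy.
by exists (m ix, m iy); rewrite /= !mem_iota ma mb xyK.
Qed.

Lemma mem_vline (m : term) k b :
  (m \in [seq xy k j | j <- iota 0 b]) = (m ix == k) && (m iy < b)%N.
Proof.
apply/mapP/andP => [[j]|[/eqP<- mb]].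
  by rewrite mem_iota => jb ->; rewrite xyEx xyEy eqxx.
by exists (m iy); rewrite ?mem_iota ?xyK.
Qed.

Lemma mem_hline (m : term) l a :
  (m \in [seq xy i l | i <- iota 0 a]) = (m ix < a)%N && (m iy == l).
Proof.
apply/mapP/andP => [[i]|[ma /eqP<-]].
  by rewrite mem_iota => ia ->; rewrite xyEx xyEy eqxx.
by exists (m ix); rewrite ?mem_iota ?xyK.
Qed.

Lemma uniq_vline k b : uniq [seq xy k j | j <- iota 0 b].
Proof.
rewrite map_inj_uniq ?iota_uniq // => i j /(congr1 (fun m : term => m iy)).
by rewrite !xyEy.
Qed.

Lemma uniq_hline l a : uniq [seq xy i l | i <- iota 0 a].
Proof.
rewrite map_inj_uniq ?iota_uniq // => i j /(congr1 (fun m : term => m ix)).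
by rewrite !xyEx.
Qed.

Lemma card_tnth_mem (T : eqType) n (t : n.-tuple T) (s : seq T) :
  uniq t -> uniq s -> {subset s <= t} -> #|[set i | tnth t i \in s]| = size s.
Proof.
move=> ut us sub; rewrite cardE -(size_map (tnth t)); apply: perm_size.
apply: uniq_perm => //.
  by rewrite map_inj_uniq ?enum_uniq //; apply/tuple_uniqP.
move=> x; apply/mapP/idP => [[i]|xs].
  by rewrite mem_enum inE => ? ->.
by have /tnthP[i xi] := sub _ xs; exists i; rewrite // mem_enum inE -xi.
Qed.

Section Box.
Variables (a b : nat) (a_gt0 : (0 < a)%N) (b_gt0 : (0 < b)%N).
Variables (mu nu : nat) (t : mu.-tuple term) (bd : nu.-tuple term).
Hypotheses (t_box : t =i box a b) (bd_border : bd =i border t).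

Lemma mem_t m : (m \in t) = (m ix < a)%N && (m iy < b)%N.
Proof. by rewrite t_box mem_box. Qed.

Lemma mem_bd m : (m \in bd) =
  (m ix == a) && (m iy < b)%N || (m ix < a)%N && (m iy == b).
Proof.
rewrite -(xyK m) bd_border mem_filter mem_cat mem_t !xyEx !xyEy.
move: (m ix) (m iy) => i j {m}.
apply/andP/idP => [[mt /orP[]/mapP[m']]|].
- rewrite mem_t -(xyK m') shift_ix !xyEx !xyEy => m't /eqP.
  rewrite eq_xy xyEx xyEy; move: (m' ix) (m' iy) m't => i' j'; lia.
- rewrite mem_t -(xyK m') shift_iy !xyEx !xyEy => m't /eqP.
  rewrite eq_xy xyEx xyEy; move: (m' ix) (m' iy) m't => i' j'; lia.
case/orP=> /andP[/[dup]mi + /[dup]mj +]; (split; [lia|apply/orP]).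
  left; apply/mapP; exists (xy i.-1 j); last by rewrite shift_ix prednK //; lia.
  by rewrite mem_t xyEx xyEy; lia.
right; apply/mapP; exists (xy i j.-1); last by rewrite shift_iy prednK //; lia.
by rewrite mem_t xyEx xyEy; lia.
Qed.

Lemma tnth_tP i : exists i' j', tnth t i = xy i' j' /\ (i' < a)%N && (j' < b)%N.
Proof.
exists (tnth t i ix), (tnth t i iy); split; first by rewrite xyK.
by rewrite -mem_t mem_tnth.
Qed.

Lemma tnth_bdP j : exists k l,
  tnth bd j = xy k l /\ (k == a) && (l < b)%N || (k < a)%N && (l == b).
Proof.
exists (tnth bd j ix), (tnth bd j iy); split; first by rewrite xyK.
by rewrite -mem_bd mem_tnth.
Qed.

(** Every term x^k y^b of the upper border has a neighbour in the direction of x: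
    for k < a-1 it is x^(k+1) y^b, and for k = a-1 it is x^a y^(b-1), across
    the corner x^a y^b.  A term x^a y^l has none, since x^(a+1) y^l is two
    columns away from the box. *)
Lemma exposed_xE i j :
  exposed t bd ix i j = (tnth t i \in right_rim a b) && (tnth bd j \in upper_border a b).
Proof.
rewrite /exposed mem_vline mem_hline mem_bd.
have [i1 [j1 [-> t1]]] := tnth_tP i; have [k1 [l1 [-> b1]]] := tnth_bdP j.
rewrite !shift_ix !xyEx !xyEy.
have -> : [exists j', (tnth bd j' == xy k1.+1 l1) ||
    [exists k, (k != ix) && (shift k (tnth bd j') == xy k1.+1 l1)]] =
    (k1 < a)%N && (l1 == b).
  apply/existsP/idP => [[j' /orP[|/existsP[k /andP[kx]]]]|k1U].
  - have [k2 [l2 [-> b2]]] := tnth_bdP j'; rewrite eq_xy xyEx xyEy; lia.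
  - have -> : k = iy by case: k kx => [[|[|]]] // *; apply: val_inj.
    have [k2 [l2 [-> b2]]] := tnth_bdP j'; rewrite shift_iy eq_xy xyEx xyEy; lia.
  have [k1a|k1a] := ltnP k1.+1 a.
    have /tnthP[j' j'E] : xy k1.+1 l1 \in bd by rewrite mem_bd xyEx xyEy; lia.
    by exists j'; rewrite -j'E eqxx.
  (* Across the corner: y times x^a y^(b-1) is x times x^(a-1) y^b. *)
  have /tnthP[j' j'E] : xy a b.-1 \in bd by rewrite mem_bd xyEx xyEy; lia.
  exists j'; apply/orP; right; apply/existsP; exists iy.
  rewrite -j'E shift_iy eq_xy xyEx xyEy /=; lia.
lia.
Qed.

(** Symmetric to [exposed_xE] under exchange of x and y. *)
Lemma exposed_yE i j :
  exposed t bd iy i j = (tnth t i \in upper_rim a b) && (tnth bd j \in right_border a b).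
Proof.
rewrite /exposed mem_vline mem_hline mem_bd.
have [i1 [j1 [-> t1]]] := tnth_tP i; have [k1 [l1 [-> b1]]] := tnth_bdP j.
rewrite !shift_iy !xyEx !xyEy.
have -> : [exists j', (tnth bd j' == xy k1 l1.+1) ||
    [exists k, (k != iy) && (shift k (tnth bd j') == xy k1 l1.+1)]] =
    (k1 == a) && (l1 < b)%N.
  apply/existsP/idP => [[j' /orP[|/existsP[k /andP[kx]]]]|k1U].
  - have [k2 [l2 [-> b2]]] := tnth_bdP j'; rewrite eq_xy xyEx xyEy; lia.
  - have -> : k = ix by case: k kx => [[|[|]]] // *; apply: val_inj.
    have [k2 [l2 [-> b2]]] := tnth_bdP j'; rewrite shift_ix eq_xy xyEx xyEy; lia.
  have [l1b|l1b] := ltnP l1.+1 b.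
    have /tnthP[j' j'E] : xy k1 l1.+1 \in bd by rewrite mem_bd xyEx xyEy; lia.
    by exists j'; rewrite -j'E eqxx.
  (* Across the corner: x times x^(a-1) y^b is y times x^a y^(b-1). *)
  have /tnthP[j' j'E] : xy a.-1 b \in bd by rewrite mem_bd xyEx xyEy; lia.
  exists j'; apply/orP; right; apply/existsP; exists ix.
  rewrite -j'E shift_ix eq_xy xyEx xyEy /=; lia.
lia.
Qed.

Hypotheses (t_uniq : uniq t) (bd_uniq : uniq bd).

Lemma card_exposed l (r s : seq term) :
    (forall i j, exposed t bd l i j = (tnth t i \in r) && (tnth bd j \in s)) ->
    uniq r -> uniq s -> {subset r <= t} -> {subset s <= bd} ->
  #|[set ij : 'I_mu * 'I_nu | exposed t bd l ij.1 ij.2]| = (size r * size s)%N.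
Proof.
move=> lE ur us rt sbd; rewrite -(card_tnth_mem t_uniq ur rt).
rewrite -(card_tnth_mem bd_uniq us sbd) -cardsX; apply: eq_card => ij.
by rewrite !inE lE.
Qed.

Lemma card_exposed_x :
  #|[set ij : 'I_mu * 'I_nu | exposed t bd ix ij.1 ij.2]| = (a * b)%N.
Proof.
rewrite (card_exposed exposed_xE) ?uniq_vline ?uniq_hline //.
- by rewrite !size_map !size_iota mulnC.
- by move=> m; rewrite mem_vline mem_t; lia.
- by move=> m; rewrite mem_hline mem_bd; lia.
Qed.

Lemma card_exposed_y :
  #|[set ij : 'I_mu * 'I_nu | exposed t bd iy ij.1 ij.2]| = (a * b)%N.
Proof.
rewrite (card_exposed exposed_yE) ?uniq_vline ?uniq_hline //.
- by rewrite !size_map !size_iota.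
- by move=> m; rewrite mem_hline mem_t; lia.
- by move=> m; rewrite mem_vline mem_bd; lia.
Qed.

End Box.

(** * Indexing by exponents *)

Section IndexIn.
Variables (T : eqType) (n : nat) (n_gt0 : (0 < n)%N) (s : n.-tuple T).

Definition index_in (x : T) : 'I_n := insubd (Ordinal n_gt0) (index x s).

Lemma tnth_index_in x : x \in s -> tnth s (index_in x) = x.
Proof.
move=> xs; have lt_x : (index x s < n)%N by rewrite -[ltnRHS](size_tuple s) index_mem.
by rewrite (tnth_nth x) val_insubd lt_x nth_index.
Qed.

Lemma index_in_tnth i : uniq s -> index_in (tnth s i) = i.
Proof. by move/tuple_uniqP; apply; rewrite tnth_index_in ?mem_tnth. Qed.

End IndexIn.

Lemma sum_ord_pred (R : nmodType) n (F : nat -> R) : (0 < n)%N ->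
  \sum_(i < n) F i = \sum_(i < n.-1) F i + F n.-1.
Proof. by case: n => // n _; rewrite big_ord_recr. Qed.

Lemma sum_ord_delta (R : pzSemiRingType) n (F : nat -> R) (k : nat) :
  \sum_(i < n) (k == i :> nat)%:R * F i = if (k < n)%N then F k else 0.
Proof.
case: ltnP => [kn|nk]; last first.
  rewrite big1 // => i _; case: eqP => [ki|_]; last by rewrite mul0r.
  by have := ltn_ord i; rewrite -ki ltnNge nk.
rewrite (bigD1 (Ordinal kn)) //= eqxx mul1r big1 ?addr0 // => i.
by rewrite -val_eqE /= eq_sym => /negbTE->; rewrite mul0r.
Qed.

(** * Multiplication and reduction to the box *)

(** A polynomial supported in the box is a function f of the exponents, and
    c i j k l stands for the coefficient at x^i y^j of the normal form of the
    border term x^k y^l. *)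
Section Reduction.
Variables (a b : nat) (R : pzRingType) (c : nat -> nat -> nat -> nat -> R).
Implicit Types (f : nat -> nat -> R).

(** The coefficient at x^i y^j of x f: a shift to the right, plus the terms
    that leave the box through the right border, replaced by their normal
    forms. *)
Definition mulx f i j :=
  (if i is i'.+1 then f i' j else 0) + \sum_(l < b) f a.-1 l * c i j a l.

Definition muly f i j :=
  (if j is j'.+1 then f i j' else 0) + \sum_(k < a) f k b.-1 * c i j k b.

(** The coefficient at x^i y^j of the normal form of x^k y^l, for a term in the
    box or in its border. *)
Definition nf k l i j :=
  if (k < a)%N && (l < b)%N then ((i == k) && (j == l))%:R else c i j k l.

End Reduction.

Section ReductionTheory.
Variables (a b : nat) (a_gt0 : (0 < a)%N) (b_gt0 : (0 < b)%N).
Variables (R : pzRingType) (c : nat -> nat -> nat -> nat -> R).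
Implicit Types (f : nat -> nat -> R).

Lemma eq_mulx f g i j : (i < a)%N -> (j < b)%N ->
    (forall i j, (i < a)%N -> (j < b)%N -> f i j = g i j) ->
  mulx a b c f i j = mulx a b c g i j.
Proof.
move=> ia jb fg; rewrite /mulx; congr (_ + _).
  by case: i ia => // i ia; rewrite fg // ltnW.
by apply: eq_bigr => l _; rewrite fg ?prednK.
Qed.

Lemma eq_muly f g i j : (i < a)%N -> (j < b)%N ->
    (forall i j, (i < a)%N -> (j < b)%N -> f i j = g i j) ->
  muly a b c f i j = muly a b c g i j.
Proof.
move=> ia jb fg; rewrite /muly; congr (_ + _).
  by case: j jb => // j jb; rewrite fg // ltnW.
by apply: eq_bigr => l _; rewrite fg ?prednK.
Qed.

(** For k < a-1 nothing is reduced; for k = a-1 the shift vanishes and the sum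
    picks the normal form of x^a y^l. *)
Lemma mulx_nf k l i j : (k < a)%N -> (l < b)%N -> (i < a)%N -> (j < b)%N ->
  mulx a b c (nf a b c k l) i j = nf a b c k.+1 l i j.
Proof.
move=> ka lb ia jb; rewrite /mulx /nf ka lb /= andbT.
have [k1a|k1a] := ltnP k.+1 a.
  rewrite big1 ?addr0; first by case: i ia.
  by move=> l' _; rewrite (_ : a.-1 == k = false) ?mul0r //; lia.
have -> : a.-1 == k by lia.
under eq_bigr do rewrite eq_sym.
rewrite /= (sum_ord_delta _ (c i j a)) lb (_ : k.+1 = a); last by lia.
case: i ia => [|i] ia; rewrite ?add0r //.
by rewrite (_ : i == k = false) ?add0r //; lia.
Qed.

Lemma muly_nf k l i j : (k < a)%N -> (l < b)%N -> (i < a)%N -> (j < b)%N ->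
  muly a b c (nf a b c k l) i j = nf a b c k l.+1 i j.
Proof.
move=> ka lb ia jb; rewrite /muly /nf ka lb /=.
have [l1b|l1b] := ltnP l.+1 b.
  rewrite big1 ?addr0; first by case: j jb => // ?; rewrite ?andbF.
  by move=> l' _; rewrite (_ : b.-1 == l = false) ?andbF ?mul0r //; lia.
have -> : b.-1 == l by lia.
under eq_bigr do rewrite eq_sym andbT.
rewrite /= (sum_ord_delta _ (c i j ^~ b)) ka (_ : l.+1 = b); last by lia.
case: j jb => [|j] jb; rewrite ?add0r //.
by rewrite (_ : j == l = false) ?andbF ?add0r //; lia.
Qed.

End ReductionTheory.

(** * Solving for the non-exposed coefficients *)

Section Rules.
Variables (a b : nat) (R : pzRingType) (c : nat -> nat -> nat -> nat -> R).

(** What the commutation relations say that the non-exposed c i j k l is, with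
    relations chosen so that the result is triangular.  With p and q as above:
    for k = a, p_l at x^i y^j is read off y p_l at x^i y^(j+1), which is
    p_(l+1), or x q_(a-1) if l = b-1; for k <= i, q_k at x^i y^j is read off
    x q_k = q_(k+1) at x^(i+1) y^j; for k > i, q_k = x q_(k-1) is read at
    x^i y^j itself. *)
Definition solved_coef (i j k l : nat) : R :=
  if k == a then
    (if (l.+1 < b)%N then c i j.+1 a l.+1
     else mulx a b c (fun i j => c i j a.-1 b) i j.+1)
    - \sum_(k' < a) c k' b.-1 a l * c i j.+1 k' b
  else if (k <= i)%N then
    c i.+1 j k.+1 b - \sum_(l' < b) c a.-1 l' k b * c i.+1 j a l'
  else mulx a b c (fun i j => c i j k.-1 b) i j.

End Rules.

Lemma rmorph_mulx a b (R S : pzRingType) (phi : {rmorphism R -> S}) c f i j :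
  phi (mulx a b c f i j) =
    mulx a b (fun i j k l => phi (c i j k l)) (fun i j => phi (f i j)) i j.
Proof.
rewrite /mulx rmorphD rmorph_sum; congr (_ + _).
  by case: i => [|i] //; rewrite rmorph0.
by apply: eq_bigr => l _; rewrite rmorphM.
Qed.

Lemma rmorph_solved_coef a b (R S : pzRingType) (phi : {rmorphism R -> S}) c i j k l :
  phi (solved_coef a b c i j k l) = solved_coef a b (fun i j k l => phi (c i j k l)) i j k l.
Proof.
rewrite /solved_coef; case: ifP => _.
  rewrite rmorphB rmorph_sum; congr (_ - _).
    by case: ifP => // _; rewrite rmorph_mulx.
  by apply: eq_bigr => k' _; rewrite rmorphM.
case: ifP => _; last exact: rmorph_mulx.
rewrite rmorphB rmorph_sum; congr (_ - _).
by apply: eq_bigr => l' _; rewrite rmorphM.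
Qed.

Section BoxIndices.
Variables (a b : nat) (a_gt0 : (0 < a)%N) (b_gt0 : (0 < b)%N).
Variables (mu nu : nat) (t : mu.-tuple term) (bd : nu.-tuple term).
Hypotheses (t_uniq : uniq t) (t_box : t =i box a b).
Hypotheses (bd_uniq : uniq bd) (bd_border : bd =i border t).

Definition on_border k l := (k == a) && (l < b)%N || (k < a)%N && (l == b).

Lemma mu_gt0 : (0 < mu)%N.
Proof.
have : xy 0 0 \in t by rewrite (mem_t t_box) xyEx xyEy a_gt0.
by case/tnthP => i _; apply: leq_ltn_trans (ltn_ord i).
Qed.

Lemma nu_gt0 : (0 < nu)%N.
Proof.
have : xy a 0 \in bd by rewrite (mem_bd a_gt0 b_gt0 t_box bd_border) xyEx xyEy; lia.
by case/tnthP => i _; apply: leq_ltn_trans (ltn_ord i).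
Qed.

Definition tidx i j : 'I_mu := index_in mu_gt0 t (xy i j).
Definition bidx k l : 'I_nu := index_in nu_gt0 bd (xy k l).

(** The index in C of the coefficient at x^i y^j of the normal form of
    x^k y^l. *)
Definition cidx i j k l : 'I_(mu * nu) := mxvec_index (tidx i j) (bidx k l).

Lemma tnth_tidx i j : (i < a)%N -> (j < b)%N -> tnth t (tidx i j) = xy i j.
Proof.
by move=> ia jb; rewrite tnth_index_in // (mem_t t_box) xyEx xyEy ia.
Qed.

Lemma tnth_bidx k l : on_border k l -> tnth bd (bidx k l) = xy k l.
Proof.
move=> kl; rewrite tnth_index_in // (mem_bd a_gt0 b_gt0 t_box bd_border).
by rewrite xyEx xyEy.
Qed.

Lemma tidxP s : exists i j, [/\ (i < a)%N, (j < b)%N & s = tidx i j].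
Proof.
have [i [j [sE /andP[ia jb]]]] := tnth_tP t_box s.
by exists i, j; split=> //; rewrite /tidx -sE index_in_tnth.
Qed.

Lemma bidxP s : exists k l, on_border k l /\ s = bidx k l.
Proof.
have [k [l [sE kl]]] := tnth_bdP a_gt0 b_gt0 t_box bd_border s.
by exists k, l; split=> //; rewrite /bidx -sE index_in_tnth.
Qed.

Lemma cidxP z : exists i j k l,
  [/\ (i < a)%N, (j < b)%N, on_border k l & z = cidx i j k l].
Proof.
case/mxvec_indexP: z => s m.
have [i [j [ia jb ->]]] := tidxP s; have [k [l [kl ->]]] := bidxP m.
by exists i, j, k, l.
Qed.

Lemma eq_tidx i j i' j' : (i < a)%N -> (j < b)%N -> (i' < a)%N -> (j' < b)%N ->
  (tidx i j == tidx i' j') = (i == i') && (j == j').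
Proof.
move=> ia jb ia' jb'; rewrite -(inj_eq (tuple_uniqP _ t_uniq)) !tnth_tidx //.
by rewrite eq_xy xyEx xyEy.
Qed.

Definition on_cidx A (F : nat -> nat -> nat -> nat -> A) (z : 'I_(mu * nu)) : A :=
  mxvec (\matrix_(s, m) F (tnth t s ix) (tnth t s iy) (tnth bd m ix) (tnth bd m iy))
    0 z.

Lemma on_cidxE A (F : nat -> nat -> nat -> nat -> A) i j k l :
  (i < a)%N -> (j < b)%N -> on_border k l -> on_cidx F (cidx i j k l) = F i j k l.
Proof.
by move=> ia jb kl; rewrite /on_cidx mxvecE mxE tnth_tidx // tnth_bidx // !xyEx !xyEy.
Qed.

Lemma sum_tidx (R : nmodType) (F : 'I_mu -> R) :
  \sum_s F s = \sum_(i < a) \sum_(j < b) F (tidx i j).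
Proof.
rewrite pair_bigA (reindex (fun ij : 'I_a * 'I_b => tidx ij.1 ij.2)) //=.
have [ia jb] : (forall s, (tnth t s ix < a)%N) /\ (forall s, (tnth t s iy < b)%N).
  by split=> s; have := mem_tnth s t; rewrite (mem_t t_box) => /andP[].
exists (fun s => (Ordinal (ia s), Ordinal (jb s))) => [[i j] _|s _].
  by congr (_, _); apply: val_inj; rewrite /= tnth_tidx // ?xyEx ?xyEy.
by rewrite /= /tidx xyK index_in_tnth.
Qed.

Definition nonexposed (i j k l : nat) := if k == a then (j.+1 < b)%N else (i.+1 < a)%N.

Lemma eq_solved_coef (R : pzRingType) (c c' : nat -> nat -> nat -> nat -> R) i j k l :
    (forall i j k l, (i < a)%N -> (j < b)%N -> on_border k l -> c i j k l = c' i j k l) ->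
    (i < a)%N -> (j < b)%N -> on_border k l -> nonexposed i j k l ->
  solved_coef a b c i j k l = solved_coef a b c' i j k l.
Proof.
move=> cc' ia jb kl; rewrite /nonexposed /solved_coef.
have eq_mulx_upper k' i1 j1 : (k' < a)%N -> (i1 < a)%N -> (j1 < b)%N ->
  mulx a b c (fun i j => c i j k' b) i1 j1 = mulx a b c' (fun i j => c' i j k' b) i1 j1.
  move=> k'a i1a j1b; rewrite /mulx; congr (_ + _).
    by case: i1 i1a => // i1 i1a; rewrite cc' ?(ltnW i1a) // /on_border k'a eqxx orbT.
  apply: eq_bigr => l' _.
  by rewrite !cc' ?prednK // /on_border ?k'a ?ltn_ord !eqxx ?orbT.
case: eqP kl => [->|ka] kl nex.
  have lb : (l < b)%N by move: kl; rewrite /on_border; lia.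
  congr (_ - _).
    case: ltnP => lb1; first by rewrite cc' // /on_border eqxx lb1.
    by apply: eq_mulx_upper; lia.
  apply: eq_bigr => k' _.
  by rewrite !cc' ?prednK // /on_border ?ltn_ord ?lb !eqxx ?orbT.
have {ka} [ka lE] : (k < a)%N /\ l = b by move: kl; rewrite /on_border; lia.
case: leqP => ki; last by apply: eq_mulx_upper => //; lia.
congr (_ - _); first by rewrite cc' // /on_border eqxx; lia.
apply: eq_bigr => l' _.
by rewrite !cc' ?prednK // /on_border ?ltn_ord ?ka !eqxx ?orbT.
Qed.

(** * The commutator of the multiplication matrices *)

Section EvaluatedMatrices.
Variables (R : comNzRingType) (v : 'I_(mu * nu) -> R).
Let c i j k l := v (cidx i j k l).

(** [mult_mx] with values in an arbitrary ring, so that one computation serves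
    the generic matrices and all their specializations. *)
Definition ev_mx (r : 'I_2) : 'M[R]_mu :=
  \matrix_(i, j)
    if [pick m | tnth t m == shift r (tnth t j)] is Some m then (i == m)%:R
    else if [pick m | tnth bd m == shift r (tnth t j)] is Some m
         then v (mxvec_index i m)
    else 0.

Lemma ev_mx_xy r k l i j i' j' :
    (i < a)%N -> (j < b)%N -> (i' < a)%N -> (j' < b)%N ->
    shift r (xy i' j') = xy k l -> (k < a)%N && (l < b)%N || on_border k l ->
  ev_mx r (tidx i j) (tidx i' j') = nf a b c k l i j.
Proof.
move=> ia jb ia' jb' kl kl_in; rewrite mxE tnth_tidx // kl /nf.
case: pickP => [m /eqP mE|tN].
  have := mem_tnth m t; rewrite mE (mem_t t_box) xyEx xyEy => kl_box.
  have -> : m = tidx k l by rewrite /tidx -mE index_in_tnth.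
  by rewrite kl_box eq_tidx //; case/andP: kl_box.
have /negbTE-> : ~~ ((k < a)%N && (l < b)%N).
  by apply/negP => /andP[ka lb]; have := tN (tidx k l); rewrite tnth_tidx // eqxx.
have kl_bd : on_border k l.
  case/orP: kl_in => // /andP[ka lb].
  by have := tN (tidx k l); rewrite tnth_tidx // eqxx.
case: pickP => [m /eqP mE|bN]; last by have := bN (bidx k l); rewrite tnth_bidx // eqxx.
by rewrite /c /cidx /bidx -mE index_in_tnth.
Qed.

Lemma ev_mx_x i j i' j' : (i < a)%N -> (j < b)%N -> (i' < a)%N -> (j' < b)%N ->
  ev_mx ix (tidx i j) (tidx i' j') = nf a b c i'.+1 j' i j.
Proof.
move=> ia jb ia' jb'; apply: ev_mx_xy; rewrite ?shift_ix //.
rewrite /on_border; lia.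
Qed.

Lemma ev_mx_y i j i' j' : (i < a)%N -> (j < b)%N -> (i' < a)%N -> (j' < b)%N ->
  ev_mx iy (tidx i j) (tidx i' j') = nf a b c i' j'.+1 i j.
Proof.
move=> ia jb ia' jb'; apply: ev_mx_xy; rewrite ?shift_iy //.
rewrite /on_border; lia.
Qed.

(** Splitting off the last column of the box separates the two summands of
    [mulx]: the columns i' < a-1 of the matrix are unit vectors, and the last
    one contains the normal forms of the right border. *)
Lemma mul_ev_mx_x p (M : 'M[R]_(mu, p)) i j s : (i < a)%N -> (j < b)%N ->
  (ev_mx ix *m M) (tidx i j) s = mulx a b c (fun i j => M (tidx i j) s) i j.
Proof.
move=> ia jb; rewrite mxE sum_tidx (sum_ord_pred (fun i' => \sum_(j' < b)
  ev_mx ix (tidx i j) (tidx i' j') * M (tidx i' j') s)) // /mulx; congr (_ + _); last first.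
  apply: eq_bigr => l _; rewrite ev_mx_x ?prednK //.
  by rewrite /nf ltnn mulrC.
transitivity (\sum_(i' < a.-1) (i == i'.+1)%:R * M (tidx i' j) s).
  apply: eq_bigr => -[i' /= i'a] _; have i'1a : (i'.+1 < a)%N by lia.
  transitivity (\sum_(j' < b) (j == j')%:R * ((i == i'.+1)%:R * M (tidx i' j') s)).
    apply: eq_bigr => -[j' /= j'b] _; rewrite ev_mx_x //; last by lia.
    by rewrite /nf i'1a j'b mulrA -natrM mulnb andbC.
  by rewrite (sum_ord_delta _ (fun j' => _ * M (tidx i' j') s)) jb.
case: i ia => [_|i ia]; first by rewrite big1 // => i' _; rewrite mul0r.
rewrite (sum_ord_delta _ (fun i' => M (tidx i' j) s)) (_ : (i < a.-1)%N) //; lia.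
Qed.

Lemma mul_ev_mx_y p (M : 'M[R]_(mu, p)) i j s : (i < a)%N -> (j < b)%N ->
  (ev_mx iy *m M) (tidx i j) s = muly a b c (fun i j => M (tidx i j) s) i j.
Proof.
move=> ia jb; rewrite mxE sum_tidx exchange_big (sum_ord_pred (fun j' => \sum_(i' < a)
  ev_mx iy (tidx i j) (tidx i' j') * M (tidx i' j') s)) // /muly; congr (_ + _); last first.
  apply: eq_bigr => k _; rewrite ev_mx_y ?prednK //.
  by rewrite /nf ltnn andbF mulrC.
transitivity (\sum_(j' < b.-1) (j == j'.+1)%:R * M (tidx i j') s).
  apply: eq_bigr => -[j' /= j'b] _; have j'1b : (j'.+1 < b)%N by lia.
  transitivity (\sum_(i' < a) (i == i')%:R * ((j == j'.+1)%:R * M (tidx i' j') s)).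
    apply: eq_bigr => -[i' /= i'a] _; rewrite ev_mx_y //; last by lia.
    by rewrite /nf j'1b i'a mulrA -natrM mulnb.
  by rewrite (sum_ord_delta _ (fun i' => _ * M (tidx i' j') s)) ia.
case: j jb => [_|j jb]; first by rewrite big1 // => i' _; rewrite mul0r.
rewrite (sum_ord_delta _ (fun j' => M (tidx i j') s)) (_ : (j < b.-1)%N) //; lia.
Qed.

Definition commutator_mx : 'M[R]_mu := ev_mx ix *m ev_mx iy - ev_mx iy *m ev_mx ix.

(** The column of x^i' y^j' is x (y x^i' y^j') - y (x x^i' y^j'), each inner
    product being a normal form of a single term. *)
Lemma commutator_mxE i j i' j' : (i < a)%N -> (j < b)%N -> (i' < a)%N -> (j' < b)%N ->
  commutator_mx (tidx i j) (tidx i' j') =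
    mulx a b c (nf a b c i' j'.+1) i j - muly a b c (nf a b c i'.+1 j') i j.
Proof.
move=> ia jb ia' jb'; rewrite mxE [X in _ + X]mxE mul_ev_mx_x // mul_ev_mx_y //.
congr (_ - _).
  by apply: eq_mulx => // *; rewrite ev_mx_y.
by apply: eq_muly => // *; rewrite ev_mx_x.
Qed.


Lemma commutator_mx_inner i j i' j' :
    (i < a)%N -> (j < b)%N -> (i'.+1 < a)%N -> (j'.+1 < b)%N ->
  commutator_mx (tidx i j) (tidx i' j') = 0.
Proof.
move=> ia jb ia' jb'; rewrite commutator_mxE ?(ltnW ia') ?(ltnW jb') //.
by rewrite mulx_nf ?muly_nf ?subrr // ltnW.
Qed.

(** In the rows x^i y^0 the product y p_l contains no shifted coefficient of p_l
    to solve for; the entries there are left out of the triangular system. *)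
Lemma commutator_mx_right i j l : (i < a)%N -> (j.+1 < b)%N -> (l < b)%N ->
  commutator_mx (tidx i j.+1) (tidx a.-1 l) = solved_coef a b c i j a l - c i j a l.
Proof.
move=> ia jb lb; rewrite commutator_mxE ?prednK // /solved_coef eqxx [muly _ _ _ _ _ _]/muly.
rewrite {2 3}/nf ltnn /=; set S := \sum_(k' < a) _.
rewrite opprD addrA addrAC; congr (_ - _ - _).
case: ltnP => lb'; first by rewrite mulx_nf ?prednK // /nf ltnn.
by apply: eq_mulx => // i1 j1 _ _; rewrite /nf (_ : l.+1 = b) ?ltnn ?andbF //; lia.
Qed.

Lemma commutator_mx_upper i j k : (i < a)%N -> (j < b)%N -> (k.+1 < a)%N ->
  commutator_mx (tidx i j) (tidx k b.-1) =
    mulx a b c (fun i j => c i j k b) i j - c i j k.+1 b.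
Proof.
move=> ia jb ka; rewrite commutator_mxE ?(ltnW ka) ?prednK //; congr (_ - _).
  by apply: eq_mulx => // i1 j1 _ _; rewrite /nf ltnn andbF.
by rewrite muly_nf ?prednK // /nf ltnn andbF.
Qed.

Lemma commutator_mx_upper_le i j k : (i.+1 < a)%N -> (j < b)%N -> (k <= i)%N ->
  commutator_mx (tidx i.+1 j) (tidx k b.-1) = c i j k b - solved_coef a b c i j k b.
Proof.
move=> ia jb ki; rewrite commutator_mx_upper //; last by lia.
by rewrite /solved_coef ki (_ : k == a = false) /mulx ?opprB ?addrA //; lia.
Qed.

Lemma commutator_mx_upper_gt i j k : (i <= k)%N -> (j < b)%N -> (k.+1 < a)%N ->
  commutator_mx (tidx i j) (tidx k b.-1) = solved_coef a b c i j k.+1 b - c i j k.+1 b.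
Proof.
move=> ik jb ka; rewrite commutator_mx_upper //; last by lia.
by rewrite /solved_coef (_ : k.+1 == a = false) 1?ltnNge ?ik //; lia.
Qed.

Section Solutions.
Hypothesis c_solved : forall i j k l, (i < a)%N -> (j < b)%N -> on_border k l ->
  nonexposed i j k l -> c i j k l = solved_coef a b c i j k l.

(** The triangular system accounts for every entry of the commutator, except
    the entries in a row x^i and a column x^(a-1) y^l. *)
Lemma commutator_mx_solution i j i' j' :
    (i < a)%N -> (j < b)%N -> (i' < a)%N -> (j' < b)%N ->
    (0 < j)%N || (i'.+1 < a)%N ->
  commutator_mx (tidx i j) (tidx i' j') = 0.
Proof.
move=> ia jb ia' jb' nz; case: (ltnP i'.+1 a) nz => [i1a _|i1a].
  have [j1b|j1b] := ltnP j'.+1 b; first exact: commutator_mx_inner.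
  have -> : j' = b.-1 by lia.
  have [ii'|i'i] := leqP i i'.
    rewrite commutator_mx_upper_gt // -c_solved ?subrr // /on_border /nonexposed; first by lia.
    by rewrite (_ : i'.+1 == a = false); lia.
  case: i ia i'i => // i ia i'i.
  rewrite commutator_mx_upper_le // -c_solved ?subrr // /on_border /nonexposed; try lia.
  by rewrite (_ : i' == a = false); lia.
have -> : i' = a.-1 by lia.
case: j jb => // j jb _; rewrite commutator_mx_right // -c_solved ?subrr //.
- exact: ltnW.
- by rewrite /on_border; lia.
- by rewrite /nonexposed eqxx.
Qed.

End Solutions.

End EvaluatedMatrices.

Lemma map_ev_mx (R S : comNzRingType) (f : {rmorphism R -> S}) v r :
  map_mx f (ev_mx v r) = ev_mx (f \o v) r.
Proof.
apply/matrixP => i j; rewrite !mxE; case: pickP => [m _|_].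
  by rewrite rmorph_nat.
by case: pickP => [m _|_] //=; rewrite rmorph0.
Qed.

Lemma map_commutator_mx (R S : comNzRingType) (f : {rmorphism R -> S}) v :
  map_mx f (commutator_mx v) = commutator_mx (f \o v).
Proof. by rewrite /commutator_mx map_mxB !map_mxM !map_ev_mx. Qed.

Lemma Cexp_cidx (i j k l : nat) : (i < a)%N -> (j < b)%N -> on_border k l ->
  (cidx i j k l \in Cexp t bd) = if k == a then j == b.-1 else i == a.-1.
Proof.
move=> ia jb kl.
have -> : (cidx i j k l \in Cexp t bd) =
    exposed t bd ix (tidx i j) (bidx k l) || exposed t bd iy (tidx i j) (bidx k l).
  apply/imsetP/idP => [[[s m]] /=|ex]; last by exists (tidx i j, bidx k l); rewrite ?inE.
  rewrite inE /= => ex.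
  by rewrite /cidx => /cast_ord_inj/enum_rank_inj[-> ->].
rewrite (exposed_xE a_gt0 b_gt0 t_box bd_border).
rewrite (exposed_yE a_gt0 b_gt0 t_box bd_border).
rewrite !mem_vline !mem_hline tnth_tidx // tnth_bidx // !xyEx !xyEy.
rewrite /on_border in kl; case: (k =P a) kl => [->|ka]. rewrite ltnn; lia. lia.
Qed.


(** * The trace identities *)

Section TraceRelations.
Variables (R : comNzRingType) (v : 'I_(mu * nu) -> R).
Let c i j k l := v (cidx i j k l).
Let X := ev_mx v ix.
Hypothesis c_solved : forall i j k l, (i < a)%N -> (j < b)%N -> on_border k l ->
  nonexposed i j k l -> c i j k l = solved_coef a b c i j k l.

(** The entries left open by [commutator_mx_solution], indexed by the box:
    x^i y^l stands for the row x^i and the column x^(a-1) y^l. *)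
Definition defect : 'cV[R]_mu :=
  \col_s commutator_mx v (tidx (tnth t s ix) 0) (tidx a.-1 (tnth t s iy)).

(** The coefficients of the identities tr (D X^m) = 0 as equations for the
    defect.  The exponent m runs through a l + (a-1-i), for x^i y^l in the box,
    which are the numbers below ab in the order that makes the specialization
    in [trace_mx_chain] the identity. *)
Definition trace_mx : 'M[R]_mu :=
  \matrix_(s, s') (X ^+ (a * tnth t s iy + (a.-1 - tnth t s ix)))
    (tidx a.-1 (tnth t s' iy)) (tidx (tnth t s' ix) 0).

(** X commutes with X^m, so tr (X Y X^m) = tr (Y X^m X) = tr (Y X X^m). *)
Lemma trace_commutator_mxX m : \tr (commutator_mx v *m X ^+ m) = 0.
Proof.
rewrite mulmxBl raddfB /= -!mulmxA mxtrace_mulC -mulmxA.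
have -> : X *m X ^+ m = X ^+ m *m X by rewrite -[LHS]/(X * _) -exprS exprSr.
by rewrite subrr.
Qed.

Lemma mul_commutator_mx p (M : 'M[R]_(mu, p)) i j s : (i < a)%N -> (j < b)%N ->
  (commutator_mx v *m M) (tidx i j) s =
    if j is 0%N then \sum_(l < b) commutator_mx v (tidx i 0) (tidx a.-1 l) * M (tidx a.-1 l) s
    else 0.
Proof.
move=> ia jb; rewrite mxE sum_tidx (sum_ord_pred (fun i' => \sum_(j' < b)
  commutator_mx v (tidx i j) (tidx i' j') * M (tidx i' j') s)) // big1 ?add0r => [|i' _].
  case: j jb => // j jb; rewrite big1 // => l _.
  by rewrite commutator_mx_solution ?mul0r ?prednK.
have i'a : (i'.+1 < a)%N by rewrite -[ltnRHS](prednK a_gt0) ltnS.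
by rewrite big1 // => l _; rewrite commutator_mx_solution ?mul0r ?i'a ?orbT // ltnW.
Qed.

Lemma trace_relation m :
  \sum_s (X ^+ m) (tidx a.-1 (tnth t s iy)) (tidx (tnth t s ix) 0) *
    commutator_mx v (tidx (tnth t s ix) 0) (tidx a.-1 (tnth t s iy)) = 0.
Proof.
rewrite -[RHS](trace_commutator_mxX m) /mxtrace !sum_tidx.
apply: eq_bigr => -[i /= ia] _.
transitivity ((commutator_mx v *m X ^+ m) (tidx i 0) (tidx i 0)).
  rewrite (mul_commutator_mx _ _ ia b_gt0); apply: eq_bigr => l _.
  by rewrite (tnth_tidx ia (ltn_ord l)) xyEx xyEy; apply: mulrC.
rewrite -[in RHS](prednK b_gt0) big_ord_recl /= big1 ?addr0 // => j _.
by rewrite mul_commutator_mx // -[ltnRHS](prednK b_gt0) ltnS.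
Qed.

Lemma trace_mx_defect : trace_mx *m defect = 0.
Proof.
apply/colP => s; rewrite !mxE -[RHS](trace_relation (a * tnth t s iy + (a.-1 - tnth t s ix))).
by apply: eq_bigr => s' _; rewrite !mxE.
Qed.

(** Cramer's rule: the determinant annihilates the defect. *)
Lemma commutator_mx_eq0 : GRing.lreg (\det trace_mx) -> commutator_mx v = 0.
Proof.
move=> det_reg; have defect0 : defect = 0.
  have : \det trace_mx *: defect = 0.
    by rewrite -mul_scalar_mx -mul_adj_mx -mulmxA trace_mx_defect mulmx0.
  move/colP => det0; apply/colP => s; have := det0 s.
  by rewrite mxE [RHS]mxE -(mulr0 (\det trace_mx)) => /det_reg->; rewrite mxE.
apply/matrixP => s s'; rewrite [RHS]mxE.
have [i [j [ia jb ->]]] := tidxP s; have [i' [j' [ia' jb' ->]]] := tidxP s'.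
have [nz|] := boolP ((0 < j)%N || (i'.+1 < a)%N); first exact: commutator_mx_solution.
rewrite negb_or -leqNgt -ltnNge => /andP[j0 i'a].
have -> : j = 0%N by lia.
have -> : i' = a.-1 by lia.
have /colP/(_ (tidx i j')) := defect0.
by rewrite mxE [RHS]mxE (tnth_tidx ia jb') xyEx xyEy; apply.
Qed.

End TraceRelations.

Lemma map_trace_mx (R S : comNzRingType) (f : {rmorphism R -> S}) v :
  map_mx f (trace_mx v) = trace_mx (f \o v).
Proof.
apply/matrixP => s s'; rewrite !mxE -map_ev_mx -rmorphXn /=; by rewrite mxE.
Qed.

(** The normal forms modulo (x^a - y, y^b): x^a y^l reduces to y^(l+1), or to 0
    if l = b-1, and x^k y^b reduces to 0. *)
Definition chain_coef (R : pzRingType) (i j k l : nat) : R :=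
  [&& k == a, i == 0%N & j == l.+1]%:R.

Lemma chain_coef_solved (R : pzRingType) i j k l :
    (i < a)%N -> (j < b)%N -> on_border k l -> nonexposed i j k l ->
  chain_coef R i j k l = solved_coef a b (chain_coef R) i j k l.
Proof.
have chain0 i' j' k' l' : (k' < a)%N -> chain_coef R i' j' k' l' = 0.
  by move=> ka; rewrite /chain_coef (_ : k' == a = false) //; lia.
move=> ia jb; rewrite /on_border /nonexposed /solved_coef; case: eqP => [-> | ka] kl nex.
  rewrite big1 ?subr0 => [|k' _]; last by rewrite [X in _ * X]chain0 ?mulr0.
  case: ltnP => lb; first by rewrite /chain_coef eqSS.
  rewrite /mulx big1 => [|l' _]; last by rewrite chain0 ?mul0r //; lia.
  rewrite addr0 /chain_coef (_ : j == l.+1 = false) ?andbF; last by lia.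
  by case: i {ia} => // i; rewrite (_ : a.-1 == a = false) //; lia.
rewrite chain0; last by lia.
case: leqP => ki.
  rewrite chain0 ?big1 ?subr0 // => [l' _|]; last by lia.
  by rewrite chain0 ?mul0r //; lia.
rewrite /mulx big1 => [|l' _]; last by rewrite chain0 ?mul0r //; lia.
by rewrite addr0; case: i {ia nex} ki => // i ki; rewrite chain0 //; lia.
Qed.

Lemma eq_box_rank i j i' j' : (i < a)%N -> (i' < a)%N ->
  (a * j + i == a * j' + i')%N = (i == i') && (j == j').
Proof.
move=> ia ia'; apply/eqP/andP => [e|[/eqP-> /eqP->]//].
have := congr1 (divn ^~ a) e; have := congr1 (modn ^~ a) e.
rewrite !(mulnC a) !modnMDl !modn_small // => ->.
by rewrite !divnMDl // !divn_small // !addn0 => ->.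
Qed.

(** As y = x^a in this quotient, x^i y^j is x^(aj+i), and the powers of x below
    x^(ab) are the box terms while the higher ones vanish. *)
Lemma ev_mxX_chain (R : comNzRingType) (v : 'I_(mu * nu) -> R) m i j i' j' :
    (forall i j k l, (i < a)%N -> (j < b)%N -> on_border k l ->
      v (cidx i j k l) = chain_coef R i j k l) ->
    (i < a)%N -> (j < b)%N -> (i' < a)%N -> (j' < b)%N ->
  (ev_mx v ix ^+ m) (tidx i j) (tidx i' j') = (a * j + i == a * j' + i' + m)%N%:R.
Proof.
move=> vE ia jb ia' jb'; elim: m i j ia jb => [|m IHm] i j ia jb.
  by rewrite expr0 mxE eq_tidx // addn0 eq_box_rank.
rewrite exprS mul_ev_mx_x // /mulx.
have chainE (l : 'I_b) : (ev_mx v ix ^+ m) (tidx a.-1 l) (tidx i' j') * v (cidx i j a l) =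
   (j == l.+1)%:R * ((i == 0) && (a * l + a == a * j' + i' + m.+1))%N%:R.
  rewrite IHm ?prednK // vE //; last by rewrite /on_border eqxx ltn_ord.
  rewrite /chain_coef eqxx /= -!natrM !mulnb; congr (_ %:R); congr nat_of_bool; lia.
under eq_bigr do rewrite chainE.
case: i ia {chainE} => [|i] ia; last first.
  by rewrite big1 ?addr0 ?IHm ?(ltnW ia) ?addnS // => l _; rewrite mulr0.
rewrite add0r addn0; case: j jb => [|j] jb.
  by rewrite big1 => [|l _]; rewrite ?mul0r // muln0 addnS.
under eq_bigr do rewrite eqSS.
rewrite (sum_ord_delta _ (fun l => (_ && (a * l + a == _))%N%:R)) ltnW //.
by rewrite mulnSr.
Qed.

(** The entry at x^i y^l and x^i' y^l' tells whether multiplication by the power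
    x^(al+a-1-i) carries x^i' to x^(a-1) y^l' = x^(al'+a-1), that is, whether
    al+a-1-i = al'+a-1-i'. *)
Lemma trace_mx_chain (R : comNzRingType) (v : 'I_(mu * nu) -> R) :
    (forall i j k l, (i < a)%N -> (j < b)%N -> on_border k l ->
      v (cidx i j k l) = chain_coef R i j k l) ->
  trace_mx v = 1%:M.
Proof.
move=> vE; apply/matrixP => s s'; rewrite !mxE.
have [i [j [ia jb ->]]] := tidxP s; have [i' [j' [ia' jb' ->]]] := tidxP s'.
rewrite (tnth_tidx ia jb) (tnth_tidx ia' jb') !xyEx !xyEy.
rewrite ev_mxX_chain ?prednK // muln0 add0n eq_tidx //.
have -> : (a * j' + a.-1 == i' + (a * j + (a.-1 - i)))%N =
  (a * j' + (a.-1 - i') == a * j + (a.-1 - i))%N by lia.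
rewrite eq_box_rank; [|lia|lia].
by congr (nat_of_bool _)%:R; lia.
Qed.

(** * The box border basis scheme *)

Section Scheme.
Variable K : fieldType.
Let n := (mu * nu)%N.
Let gen (z : 'I_n) : {mpoly K[n]} := 'X_z.
Let c i j k l := gen (cidx i j k l).

(** The weight drops by a+1 from one row of the box to the next higher one,
    which leaves room for the at most a steps that a coefficient of q_k takes
    within its row. *)
Definition level j := (a.+1 * (b - j))%N.

Lemma levelS j : (j < b)%N -> level j = (level j.+1 + a.+1)%N.
Proof. by move=> jb; rewrite /level -mulnSr subnSK. Qed.

(** Exposed indeterminates have weight 0.  Within a row the coefficients of the
    p_l come first; a coefficient of q_k at x^i is then reached in a-i steps to
    the right if k <= i, and in i+1 steps to the left if k > i. *)
Definition coef_weight (i j k l : nat) : nat :=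
  if k == a then if (j.+1 < b)%N then level j else 0%N
  else if (i.+1 < a)%N
       then (level j + if (k <= i)%N then a - i else i.+1)%N else 0%N.

Let w := on_cidx coef_weight.
Let h := on_cidx (solved_coef a b c).

Lemma coef_weight_right k l : (k < a)%N -> coef_weight k b.-1 a l = 0%N.
Proof. by rewrite /coef_weight eqxx prednK // ltnn. Qed.

Lemma coef_weight_upper l k : (k < a)%N -> coef_weight a.-1 l k b = 0%N.
Proof. by move=> ka; rewrite /coef_weight prednK // ltnn (_ : k == a = false) //; lia. Qed.

Lemma weight_lt_coef d i j k l : (i < a)%N -> (j < b)%N -> on_border k l ->
  (coef_weight i j k l < d)%N -> weight_lt w d (c i j k l).
Proof. by move=> ia jb kl lt_d; apply: weight_ltX; rewrite /w on_cidxE. Qed.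

Lemma weight_lt_right_terms d l i j : (l < b)%N -> (i < a)%N -> (j < b)%N ->
    (forall k, (k < a)%N -> (coef_weight i j k b < d)%N) ->
  weight_lt w d (\sum_(k < a) c k b.-1 a l * c i j k b).
Proof.
move=> lb ia jb lt_d; apply: weight_lt_sum => k; apply: weight_ltXM.
  by rewrite /w on_cidxE ?prednK ?coef_weight_right // /on_border eqxx lb.
by apply: weight_lt_coef; rewrite ?lt_d // /on_border ltn_ord eqxx orbT.
Qed.

Lemma weight_lt_upper_terms d k i j : (k < a)%N -> (i < a)%N -> (j < b)%N ->
    (forall l, (l < b)%N -> (coef_weight i j a l < d)%N) ->
  weight_lt w d (\sum_(l < b) c a.-1 l k b * c i j a l).
Proof.
move=> ka ia jb lt_d; apply: weight_lt_sum => l; apply: weight_ltXM.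
  by rewrite /w on_cidxE ?prednK ?coef_weight_upper // /on_border eqxx ka orbT.
by apply: weight_lt_coef; rewrite ?lt_d // /on_border ltn_ord eqxx.
Qed.

Lemma weight_lt_mulx d k i j : (k < a)%N -> (i < a)%N -> (j < b)%N ->
    (forall i', i = i'.+1 -> (coef_weight i' j k b < d)%N) ->
    (forall l, (l < b)%N -> (coef_weight i j a l < d)%N) ->
  weight_lt w d (mulx a b c (fun i j => c i j k b) i j).
Proof.
move=> ka ia jb lt_i lt_d; apply: weight_ltD; last exact: weight_lt_upper_terms.
case: i ia lt_i {lt_d} => [|i] ia lt_i; first exact: weight_lt0.
by apply: weight_lt_coef; rewrite ?lt_i ?(ltnW ia) // /on_border ka eqxx orbT.
Qed.

Lemma weight_lt_solved_coef i j k l :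
    (i < a)%N -> (j < b)%N -> on_border k l -> nonexposed i j k l ->
  weight_lt w (coef_weight i j k l) (solved_coef a b c i j k l).
Proof.
move=> ia jb; rewrite /on_border /nonexposed /solved_coef; case: eqP => [-> | ka] kl nex.
  have lb : (l < b)%N by lia.
  have dE : coef_weight i j a l = (level j.+1 + a.+1)%N by rewrite /coef_weight eqxx nex levelS.
  have lt_right k' : (k' < a)%N -> (coef_weight i j.+1 k' b < coef_weight i j a l)%N.
    move=> k'a; rewrite dE /coef_weight; case: eqP => [|_]; first by lia.
    by case: ifP => _; last lia; case: ifP; lia.
  apply: weight_ltD; last by apply/weight_ltN/weight_lt_right_terms.
  case: ltnP => lb1.
    apply: weight_lt_coef => //; first by rewrite /on_border eqxx lb1.
    by rewrite dE /coef_weight eqxx; case: ifP => _; lia.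
  apply: weight_lt_mulx => // [|i' iE|l' l'b]; first by lia.
    rewrite dE /coef_weight (_ : a.-1 == a = false); last by lia.
    by case: ifP => _; last lia; case: ifP; lia.
  by rewrite dE /coef_weight eqxx; case: ifP; lia.
have {ka kl} [ka ->] : (k < a)%N /\ l = b by lia.
have dE : coef_weight i j k b = (level j + if (k <= i)%N then a - i else i.+1)%N.
  by rewrite /coef_weight nex (_ : k == a = false) //; lia.
have lt_upper i' l' : (coef_weight i' j a l' < coef_weight i j k b)%N.
  by rewrite dE /coef_weight eqxx; case: ifP => _; case: ifP; lia.
case: leqP dE => ki dE.
  apply: weight_ltD; last first.
    by apply/weight_ltN/weight_lt_upper_terms.
  apply: weight_lt_coef => //; first by rewrite /on_border eqxx orbC; lia.
  rewrite dE /coef_weight (_ : k.+1 == a = false); last by lia.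
  by case: ifP => _; rewrite ?ltnS ?ki; lia.
apply: weight_lt_mulx => // [|i' iE]; first by lia.
rewrite dE /coef_weight (_ : k.-1 == a = false); last by lia.
by case: ifP => _; last lia; rewrite (_ : (k.-1 <= i')%N = false); lia.
Qed.

Lemma nonexposed_cidxP z : z \notin Cexp t bd -> exists i j k l,
  [/\ (i < a)%N, (j < b)%N, on_border k l, nonexposed i j k l & z = cidx i j k l].
Proof.
have [i [j [k [l [ia jb kl ->]]]]] := cidxP z.
rewrite Cexp_cidx // => nex; exists i, j, k, l; split=> //.
by rewrite /nonexposed; case: eqP nex; lia.
Qed.

Lemma nonexposed_notin i j k l :
    (i < a)%N -> (j < b)%N -> on_border k l -> nonexposed i j k l ->
  cidx i j k l \notin Cexp t bd.
Proof.
by move=> ia jb kl; rewrite Cexp_cidx // /nonexposed; case: eqP; lia.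
Qed.

Lemma weight_lt_h z : z \notin Cexp t bd -> weight_lt w (w z) (h z).
Proof.
case/nonexposed_cidxP=> i [j [k [l [ia jb kl nex ->]]]].
by rewrite /w /h !on_cidxE //; apply: weight_lt_solved_coef.
Qed.

Lemma commutator_mx_mem i j : bbs_ideal t bd K (commutator_mx gen i j).
Proof.
exists (fun ij => (ij == (i, j))%:R); rewrite (bigD1 (i, j)) //= eqxx mul1r big1 ?addr0 //.
by move=> ij /negbTE->; rewrite mul0r.
Qed.

Lemma solved_coef_mem z : z \notin Cexp t bd -> bbs_ideal t bd K ('X_z - h z).
Proof.
case/nonexposed_cidxP=> i [j [k [l [ia jb]]]]; rewrite /on_border => kl nex ->.
rewrite /h on_cidxE // -['X__]/(c i j k l).
have [ka|ka] := eqVneq k a.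
  rewrite ka in kl nex *; have lb : (l < b)%N by lia.
  rewrite /nonexposed eqxx in nex.
  apply: (@ideal_memBC _ (bbs_ideal t bd K)).
  rewrite -commutator_mx_right //; exact: commutator_mx_mem.
rewrite /nonexposed (negbTE ka) in nex.
have {ka kl} [ka ->] : (k < a)%N /\ l = b by lia.
have [ki|ik] := leqP k i.
  rewrite -commutator_mx_upper_le //; exact: commutator_mx_mem.
case: k ka ik => // k ka ik.
apply: (@ideal_memBC _ (bbs_ideal t bd K)).
rewrite -commutator_mx_upper_gt //; exact: commutator_mx_mem.
Qed.

Lemma bbs_separating : separating (bbs_ideal t bd K) (~: Cexp t bd).
Proof. exact: triangular_separating weight_lt_h _ solved_coef_mem. Qed.

Let Y := Cexp t bd.
Let sol := solution Y w h.
Let phi : {rmorphism {mpoly K[n]} -> {mpoly K[#|Y|]}} := mmap (@mpolyC _ K) sol.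

Lemma solution_solved_coef i j k l :
    (i < a)%N -> (j < b)%N -> on_border k l -> nonexposed i j k l ->
  sol (cidx i j k l) = solved_coef a b (fun i j k l => sol (cidx i j k l)) i j k l.
Proof.
move=> ia jb kl nex; rewrite {1}/sol (solutionE weight_lt_h) ?nonexposed_notin //.
rewrite -[LHS]/(phi _) /h on_cidxE // rmorph_solved_coef.
apply: eq_solved_coef => // *; by rewrite /phi /= mmapX mmap1U.
Qed.

Definition chain_point (k : 'I_#|Y|) : K := on_cidx (chain_coef K) (enum_val k).

Let psi : {rmorphism {mpoly K[#|Y|]} -> K} := mmap idfun chain_point.

(** Both sides solve the triangular system and agree at the exposed
    indeterminates, so the solution specializes to the chain without being
    computed. *)
Lemma psi_sol i j k l : (i < a)%N -> (j < b)%N -> on_border k l ->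
  psi (sol (cidx i j k l)) = chain_coef K i j k l.
Proof.
move=> ia jb kl; rewrite -(on_cidxE (chain_coef K)) //; move: (cidx i j k l) => z.
apply: (triangular_unique weight_lt_h (u := psi \o sol) (f := idfun)) => {i j k l ia jb kl z}.
- move=> y yY; rewrite -(enum_rankK_in yY yY) /= /sol solution_kept.
  by rewrite /psi /= mmapX mmap1U.
- move=> z zY; rewrite [LHS]/= {1}/sol (solutionE weight_lt_h) //.
  rewrite -[LHS]/((psi \o phi) (h z)).
  apply: eq_mpoly_rmorphism => [k|i] /=; first by rewrite /psi /= !mmapC.
  by rewrite /psi /= !mmapX !mmap1U.
- move=> z zY; have [i [j [k [l [ia jb kl nex ->]]]]] := nonexposed_cidxP zY.
  pose ev : {rmorphism {mpoly K[n]} -> K} := mmap idfun (on_cidx (chain_coef K)).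
  rewrite -[RHS]/(ev _) /h !on_cidxE // chain_coef_solved // rmorph_solved_coef.
  apply: eq_solved_coef => // i' j' k' l' i'a j'b kl'.
  by rewrite /ev /= mmapX mmap1U on_cidxE.
Qed.

(** The determinant of the trace identities is nonzero in the domain K[Cexp],
    because psi sends it to 1. *)
Lemma commutator_mx_sol : commutator_mx sol = 0.
Proof.
apply: commutator_mx_eq0; first exact: solution_solved_coef.
apply: mulfI; apply/eqP => det0; have := congr1 psi det0.
rewrite rmorph0 -det_map_mx map_trace_mx trace_mx_chain; last exact: psi_sol.
by rewrite det1 => /eqP; rewrite oner_eq0.
Qed.

Lemma phi_kill f : bbs_ideal t bd K f -> phi f = 0.
Proof.
case=> q ->; rewrite raddf_sum big1 // => -[i j] _ /=.
rewrite rmorphM -[X in _ * phi X]/(commutator_mx gen i j).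
have -> : phi (commutator_mx gen i j) = map_mx phi (commutator_mx gen) i j by rewrite [RHS]mxE.
rewrite map_commutator_mx.
have -> : phi \o gen = sol by apply: boolp.funext => z; rewrite /phi /= mmapX mmap1U.
by rewrite commutator_mx_sol mxE mulr0.
Qed.

Lemma bbs_reembedding :
  exists (Psi : kalg_hom (bbs_algebra t bd K)
             (kquotient (elim_ideal (bbs_ideal t bd K) Y)))
         (Phi : kalg_hom (bbs_algebra t bd K) (kpoly K #|Y|)),
    [/\ is_reembedding Psi,
        forall u, proj (elim_ideal (bbs_ideal t bd K) Y) (Phi u) = Psi u
      & kalg_iso Phi].
Proof.
apply: (@retraction_reembedding K n (bbs_ideal t bd K) Y sol) phi_kill.
  exact: solution_kept.
exact: solution_mod weight_lt_h _ solved_coef_mem.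
Qed.

Lemma bbs_affine :
  kfunctor_iso (border_basis_scheme t bd K) (affine_space K #|Y|).
Proof.
apply: (@retraction_affine K n (bbs_ideal t bd K) Y sol) phi_kill.
  exact: solution_kept.
exact: solution_mod weight_lt_h _ solved_coef_mem.
Qed.

End Scheme.

End BoxIndices.

Theorem proposition7p3 (K : fieldType) (a b : nat) (a_gt0 : (0 < a)%N)
    (b_gt0 : (0 < b)%N) (mu nu : nat) (t : mu.-tuple term)
    (bd : nu.-tuple term) (t_uniq : uniq t) (t_box : t =i box a b)
    (bd_uniq : uniq bd) (bd_border : bd =i border t) :
  [/\
   (forall (i : 'I_mu) (j : 'I_nu), exposed t bd ix i j <->
      tnth t i \in right_rim a b /\ tnth bd j \in upper_border a b) /\
   #|[set ij : 'I_mu * 'I_nu | exposed t bd ix ij.1 ij.2]| = (a * b)%N,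
   (forall (i : 'I_mu) (j : 'I_nu), exposed t bd iy i j <->
      tnth t i \in upper_rim a b /\ tnth bd j \in right_border a b) /\
   #|[set ij : 'I_mu * 'I_nu | exposed t bd iy ij.1 ij.2]| = (a * b)%N &
   [/\ separating (bbs_ideal t bd K) (~: Cexp t bd),
       exists (Psi : kalg_hom (bbs_algebra t bd K)
                 (kquotient (elim_ideal (bbs_ideal t bd K) (Cexp t bd))))
              (Phi : kalg_hom (bbs_algebra t bd K) (kpoly K #|Cexp t bd|)),
         [/\ is_reembedding Psi,
             forall u,
               proj (elim_ideal (bbs_ideal t bd K) (Cexp t bd)) (Phi u) = Psi u
           & kalg_iso Phi] &
       exists n : nat,
         kfunctor_iso (border_basis_scheme t bd K) (affine_space K n)]].
Proof.
split; last split.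
- split=> [i j|]; last exact: card_exposed_x bd_border t_uniq bd_uniq.
  by rewrite (exposed_xE a_gt0 b_gt0 t_box bd_border); split=> [/andP//|[-> ->]].
- split=> [i j|]; last exact: card_exposed_y bd_border t_uniq bd_uniq.
  by rewrite (exposed_yE a_gt0 b_gt0 t_box bd_border); split=> [/andP//|[-> ->]].
- exact: (bbs_separating a_gt0 b_gt0 t_uniq t_box bd_uniq bd_border).
- exact: (bbs_reembedding a_gt0 b_gt0 t_uniq t_box bd_uniq bd_border).
- exists #|Cexp t bd|.
  exact: (bbs_affine a_gt0 b_gt0 t_uniq t_box bd_uniq bd_border).
Qed.
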